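(* Consider the closed-loop system $x_{k+1}=Ax_k+Bu_k+Dw_k$, $u_k=v^*_{0|k}(x_k)$, under the receding horizon law described in the context, with state space $\mathbf{X}$, and assume that $(A+BK,D)$ is controllable. For any $x_0\in\mathbf{X}$, the closed-loop system satisfies $$\lim_{k\rightarrow\infty}\mathbb{P}\Bigl\{x_k\in\bigoplus_{j=0}^\infty(A+BK)^jD\mathbf{W}\Bigr\}=1$$ and $$\lim_{k\rightarrow\infty}\frac1k\sum_{j=1}^k\bigl(x_j^\top Qx_j+u_j^\top Ru_j\bigr)=\lim_{k\rightarrow\infty}\mathbb{E}\bigl\{\xi_k^\top(Q+K^\top RK)\xi_k\bigr\}\quad\text{almost surely},$$ where $\xi_{k+1}=(A+BK)\xi_k+Dw_k$ for all $k\in\mathbb{N}$ and $\xi_0=x_0$.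
   Context: System: $x_{k+1}=Ax_k+Bu_k+Dw_k$, $x_k\in\mathbb{R}^{n_x}$, $u_k\in\mathbb{R}^{n_u}$, $w_k\in\mathbb{R}^{n_w}$, $(A,B)$ stabilizable, with $x_k$ measured at time $k$. The sequence $\{w_k\in\mathbf{W}:k\in\mathbb{N}\}$ is i.i.d. with $\mathbb{E}\{w_k\}=0$ and a non-singular (with respect to Lebesgue measure) distribution supported in $\mathbf{W}$, a bounded set containing the origin in its interior, and $\mathbb{P}\{\|w\|\le\lambda\}>0$ for all $\lambda>0$. Constraints: $(x_k,u_k)\in\mathbf{Z}$ for all $k$, where $\mathbf{Z}\subseteq\mathbb{R}^{n_x}\times\mathbb{R}^{n_u}$ is convex, compact and contains the origin in its interior. Weights: $Q\succeq0$, $R\succ0$, $P\succ0$, $(A,Q^{1/2})$ detectable; $P,K$ satisfy $P=Q+A^\top PA-K^\top(R+B^\top PB)K$, $K=-(R+B^\top PB)^{-1}B^\top PA$, and $A+BK$ is Schur stable. Terminal set: $\mathbf{X}_f$ is a set containing the origin in its interior that is robustly positively invariant for the system under $u=Kx$ and the constraints, i.e. for all $x\in\mathbf{X}_f$: $(x,Kx)\in\mathbf{Z}$ and $(A+BK)x+Dw\in\mathbf{X}_f$ for all $w\in\mathbf{W}$. Optimal control problem at time $k$ with horizon $N$ ($y_{i|k}$ denotes the prediction of $y_{k+i}$ made at time $k$): minimize $$J=\mathbb{E}\Bigl\{x_{N|k}^\top Px_{N|k}+\sum_{i=0}^{N-1}\bigl(x_{i|k}^\top Qx_{i|k}+u_{i|k}^\top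 Ru_{i|k}\bigr)\Bigr\}$$ over open-loop inputs $v_{i|k}$ ($0\le i\le N-1$) and disturbance feedback gains $M_{i,j}$ ($1\le i\le N-1$, $0\le j\le i-1$), subject to $x_{0|k}=x_k$ and, for all $(w_{0|k},\dots,w_{N-1|k})\in\mathbf{W}\times\cdots\times\mathbf{W}$ and all $0\le i\le N-1$: $x_{i+1|k}=Ax_{i|k}+Bu_{i|k}+Dw_{i|k}$, $u_{i|k}=v_{i|k}+\sum_{j=0}^{i-1}M_{i,j}w_{j|k}$, $(x_{i|k},u_{i|k})\in\mathbf{Z}$, $x_{N|k}\in\mathbf{X}_f$. $\mathbf{X}$ is the set of $x_k$ for which this problem is feasible, and $v^*_{0|k}(x_k)$ is the optimal value of $v_{0|k}$. $\bigoplus$ denotes Minkowski sum, so $\bigoplus_{j=0}^\infty(A+BK)^jD\mathbf{W}=\{\sum_{j=0}^\infty(A+BK)^jDw_j:w_j\in\mathbf{W}\}$. *)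

(* Defs.v *)
From HB Require Import structures.
From mathcomp Require Import all_boot all_order all_algebra.
From mathcomp Require Import finmap complex.
From mathcomp Require Import all_classical all_reals all_analysis.
Set Implicit Arguments.
Unset Strict Implicit.
Unset Printing Implicit Defensive.
Import Order.TTheory GRing.Theory Num.Theory.
Import numFieldNormedType.Exports.
Local Open Scope classical_set_scope.
Local Open Scope ring_scope.

Section LinearSystems.
Variable R : realType.

Definition qform n (Q : 'M[R]_n) (x : 'cV[R]_n) : R := (x^T *m Q *m x) 0 0.

Definition psd n (Q : 'M[R]_n) := Q^T = Q /\ forall x, 0 <= qform Q x.

Definition pd n (Q : 'M[R]_n) := Q^T = Q /\ forall x, x != 0 -> 0 < qform Q x.

Definition is_psd_sqrt n (S Q : 'M[R]_n) := psd S /\ S *m S = Q.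

(* Eigenvalues are the complex ones. *)
Definition schur_stable n (A : 'M[R]_n) :=
  forall z : complex R, eigenvalue (map_mx (real_complex R) A) z -> `|z| < 1.

Definition stabilizable n m (A : 'M[R]_n) (B : 'M[R]_(n, m)) :=
  exists K : 'M[R]_(m, n), schur_stable (A + B *m K).

Definition detectable n p (A : 'M[R]_n) (C : 'M[R]_(p, n)) :=
  exists L : 'M[R]_(n, p), schur_stable (A + L *m C).

Fixpoint lin_traj n m (A : 'M[R]_n) (B : 'M[R]_(n, m)) (x : 'cV[R]_n)
    (u : nat -> 'cV[R]_m) (k : nat) : 'cV[R]_n :=
  if k is j.+1 then A *m lin_traj A B x u j + B *m u j else x.

(* Every state can be steered to every other state in finite time; this is
   reachability of the whole space, not merely controllability to the origin
   (the two differ in discrete time when A is singular). *)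
Definition controllable n m (A : 'M[R]_n) (B : 'M[R]_(n, m)) :=
  forall x y, exists k u, lin_traj A B x u k = y.

(* The sums x = \sum_(0 <= j < oo) A ^+ j *m D *m w j with every w j in W. *)
Definition minkowski_series n m (A : 'M[R]_n) (D : 'M[R]_(n, m))
    (W : set 'cV[R]_m) : set 'cV[R]_n :=
  [set x | exists w : nat -> 'cV[R]_m, (forall j, W (w j)) /\
    series (fun j => A ^+ j *m D *m w j) @ \oo --> x].

End LinearSystems.

Section Probability.
Variable R : realType.

Definition borel n := g_sigma_algebraType (@open 'cV[R]_n).

(* Covering by countably many boxes of arbitrarily small total volume. The
   index set D may be finite or empty. *)
Definition lebesgue_null n (E : set 'cV[R]_n) :=
  forall e : R, 0 < e -> exists (D : set nat) (a b : nat -> 'cV[R]_n),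
    [/\ forall k i, a k i 0 <= b k i 0,
        E `<=` \bigcup_(k in D) [set x | forall i, a k i 0 <= x i 0 <= b k i 0] &
        (\esum_(k in D) (\prod_i (b k i 0 - a k i 0))%:E <= e%:E)%E].

Variables (d : measure_display) (Omega : measurableType d).
Variable Pr : probability Omega R.

Definition singular_law n (X : Omega -> 'cV[R]_n) :=
  exists E : set (borel n),
    [/\ measurable E, lebesgue_null E & Pr (X @^-1` E) = 1%E].

Definition iid n (w : nat -> Omega -> 'cV[R]_n) :=
  [/\ forall k, measurable_fun setT (w k : Omega -> borel n),
      forall (J : {fset nat}) (E : nat -> set (borel n)),
        (forall k, measurable (E k)) ->
        Pr (\bigcap_(k in [set` J]) (w k @^-1` E k)) =
          (\prod_(k <- J) Pr (w k @^-1` E k))%E &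
      forall k (E : set (borel n)), measurable E ->
        Pr (w k @^-1` E) = Pr (w 0%N @^-1` E)].

(* Probability of a set of outcomes that need not be an event: {x_k \in S} can
   fail to be measurable when S is an infinite Minkowski sum (such an S need
   not be a Borel set). It is the inner measure, hence the usual probability on
   events, see prob_inE. *)
Definition prob_in (E : set Omega) : \bar R :=
  ereal_sup [set Pr F | F in [set F | measurable F /\ F `<=` E]].

Lemma prob_inE (E : set Omega) : measurable E -> prob_in E = Pr E.
Proof.
move=> mE; apply/eqP; rewrite eq_le; apply/andP; split.
  by apply: ge_ereal_sup => _ [F [mF FE] <-]; apply: le_measure; rewrite ?inE.
by apply: ereal_sup_ubound; exists E => //; split.
Qed.

End Probability.

Section RecedingHorizon.
Variables (R : realType) (nx nu nw : nat).
Variables (A : 'M[R]_nx) (B : 'M[R]_(nx, nu)) (D : 'M[R]_(nx, nw)).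

(* In a policy (v, M) of horizon N only v i with i < N and M i j with
   j < i < N are relevant; the other entries are never read. *)
Definition pred_input (v : nat -> 'cV[R]_nu) (M : nat -> nat -> 'M[R]_(nu, nw))
    (w : nat -> 'cV[R]_nw) (i : nat) : 'cV[R]_nu :=
  v i + \sum_(j < i) M i j *m w j.

Fixpoint pred_state (x : 'cV[R]_nx) (v : nat -> 'cV[R]_nu)
    (M : nat -> nat -> 'M[R]_(nu, nw)) (w : nat -> 'cV[R]_nw) (i : nat) :
    'cV[R]_nx :=
  if i is j.+1 then
    A *m pred_state x v M w j + B *m pred_input v M w j + D *m w j
  else x.

Definition feasible (W : set 'cV[R]_nw) (Z : set ('cV[R]_nx * 'cV[R]_nu))
    (Xf : set 'cV[R]_nx) (N : nat) (x : 'cV[R]_nx)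
    (v : nat -> 'cV[R]_nu) (M : nat -> nat -> 'M[R]_(nu, nw)) :=
  forall w : nat -> 'cV[R]_nw, (forall i, (i < N)%N -> W (w i)) ->
    (forall i, (i < N)%N -> Z (pred_state x v M w i, pred_input v M w i)) /\
    Xf (pred_state x v M w N).

Definition feasible_set W Z Xf N : set 'cV[R]_nx :=
  [set x | exists v M, feasible W Z Xf N x v M].

Variables (d : measure_display) (Omega : measurableType d).
Variable Pr : probability Omega R.

(* w_{i|k} has the law of w_i: the disturbances are i.i.d., so w_0, ..., w_(N-1)
   can serve as the predicted ones at every time k. *)
Definition cost (Q : 'M[R]_nx) (Rw : 'M[R]_nu) (P : 'M[R]_nx)
    (w : nat -> Omega -> 'cV[R]_nw) (N : nat) (x : 'cV[R]_nx)
    (v : nat -> 'cV[R]_nu) (M : nat -> nat -> 'M[R]_(nu, nw)) : \bar R :=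
  'E_Pr[fun om => qform P (pred_state x v M (w^~ om) N) +
    \sum_(i < N) (qform Q (pred_state x v M (w^~ om) i) +
                  qform Rw (pred_input v M (w^~ om) i))].

Definition optimal Q Rw P w W Z Xf N x v M :=
  feasible W Z Xf N x v M /\
  forall v' M', feasible W Z Xf N x v' M' ->
    (cost Q Rw P w N x v M <= cost Q Rw P w N x v' M')%E.

(* kappa x is the first open-loop input of some minimizer, for each x for which
   the problem is feasible; its values at other x are irrelevant. *)
Definition receding_horizon_law Q Rw P w W Z Xf N
    (kappa : 'cV[R]_nx -> 'cV[R]_nu) :=
  forall x, feasible_set W Z Xf N x ->
    exists v M, optimal Q Rw P w W Z Xf N x v M /\ kappa x = v 0%N.

Fixpoint closed_loop (kappa : 'cV[R]_nx -> 'cV[R]_nu) (x0 : 'cV[R]_nx)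
    (w : nat -> 'cV[R]_nw) (k : nat) : 'cV[R]_nx :=
  if k is j.+1 then
    A *m closed_loop kappa x0 w j + B *m kappa (closed_loop kappa x0 w j) +
    D *m w j
  else x0.

End RecedingHorizon.

(* Main.v *)
Require Import Defs.
From HB Require Import structures.
From mathcomp Require Import all_boot all_order all_algebra.
From mathcomp Require Import finmap complex.
From mathcomp Require Import all_classical all_reals all_analysis.
From mathcomp Require Import measurable_realfun zify ring lra.

(**
Write [Phi = A + B K], [S = Rw + B^T P B] and let [c(x) = kappa x - K x] be the
correction that the receding horizon law adds to the linear feedback.
Completing the square with the Riccati equation gives, for the state [x], the
input [u] and the next state [x'] under the disturbance [e],
  [x^T Q x + u^T Rw u = x^T P x - x'^T P x' + (u - K x)^T S (u - K x)
     + (D e)^T P (D e) + (a term linear in e)].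

The excess decreases.  Since the noise is centred and independent of the past,
the cost of a policy is [x^T P x] plus a multiple of [ell = E (D w)^T P (D w)]
plus an excess, the expected sum of the squares [|u_i - K x_i|^2_S]
([cost_excess]), so an optimal policy minimises the excess.  After one step the
tail of an optimal policy, completed by the input [K x_N] in the terminal set,
is feasible and affine in the new disturbances; on average its excess is the
old one minus [|c(x)|^2_S] ([Ex_excess_shift]).  Iterating along the closed loop
bounds [sum_k E |c(x_k)|^2_S] by the initial excess, hence
[sum_k |c(x_k)|^2_S] is almost surely finite ([ae_excess_sums_bounded]).  The
minimal excess need not depend measurably on the state, so the iteration runs
on the cumulated excess [excess_to_go], a measurable function of the state that
the excess of each feasible policy dominates ([excess_to_go_le]).

Average cost.  Summing the identity above along the closed loop, the terms in
[P] telescope, the squares have a finite sum, and the remaining terms are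
[k * ell] plus a martingale with bounded increments, which is [o(k)] almost
surely ([martingale_lln]).  So the average cost tends to [ell].  The same
identity for the linear response [xi] expresses [E xi_k^T (Q + K^T Rw K) xi_k]
as [ell] plus terms that vanish with [Phi^k] ([cvg_noise_response_cost]).

Absorption.  By controllability a ball around 0 lies in the Minkowski series as
well as in the terminal set.  In the terminal set the policy [u = K x] is
feasible with zero excess, so there [c = 0] ([terminal_correction0]); both sets
are therefore invariant from the moment the state enters the ball
([absorbed]).  The state does enter it almost surely ([ae_hit_ball]): [c(x_k)]
tends to 0, the noise is small during arbitrarily late blocks of a prescribed
length ([ae_small_blocks]), and over a long such block [Phi] contracts the
bounded state.
*)

Set Implicit Arguments.
Unset Strict Implicit.
Unset Printing Implicit Defensive.
Import Order.TTheory GRing.Theory Num.Theory.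
Import numFieldNormedType.Exports.
Local Open Scope classical_set_scope.
Local Open Scope ring_scope.

(** * Norms, quadratic forms and completion of squares *)

Section MatrixNorm.
Variable R : realType.

Lemma entry_le_norm m n (X : 'M[R]_(m, n)) i j : `|X i j| <= `|X|.
Proof.
rewrite [leRHS](mx_normrE X).
exact: (le_bigmax _ (fun ij : 'I_m * 'I_n => `|X ij.1 ij.2|) (i, j)).
Qed.

Lemma norm_le_entries m n (X : 'M[R]_(m, n)) c :
  0 <= c -> (forall i j, `|X i j| <= c) -> `|X| <= c.
Proof.
move=> c0 Xc; rewrite [leLHS](mx_normrE X); exact: bigmax_le.
Qed.

Lemma norm_mulmx_le m n p (X : 'M[R]_(m, n)) (Y : 'M[R]_(n, p)) :
  `|X *m Y| <= n%:R * `|X| * `|Y|.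
Proof.
apply: norm_le_entries => [|i j]; first by rewrite !mulr_ge0.
rewrite mxE (le_trans (ler_norm_sum _ _ _))// -mulrA.
have -> c : n%:R * c = \sum_(k < n) c :> R.
  by rewrite sumr_const card_ord mulr_natl.
by apply: ler_sum => k _; rewrite normrM ler_pM// entry_le_norm.
Qed.

Lemma norm_trmx_le m n (X : 'M[R]_(m, n)) : `|X^T| <= `|X|.
Proof. by apply: norm_le_entries => // i j; rewrite mxE entry_le_norm. Qed.

Lemma cvg_mx0P m n (F : nat -> 'M[R]_(m, n)) :
  (forall i j, (fun k => F k i j) @ \oo --> 0) <->
  F @ \oo --> (0 : 'M[R]_(m, n)).
Proof.
split=> [Fij|F0 i j].
  apply/cvgr0Pnorm_le => e e0.
  suff: \forall k \near \oo, forall ij : 'I_m * 'I_n, `|F k ij.1 ij.2| <= e.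
    by apply: filterS => k Fk; apply: norm_le_entries (ltW e0) _ => i j;
      exact: (Fk (i, j)).
  apply: filter_forall => -[i j] /=.
  by have /cvgr0Pnorm_le/(_ e e0) := Fij i j.
apply/cvgr0Pnorm_le => e e0; have /cvgr0Pnorm_le/(_ e e0) := F0.
by apply: filterS => k; apply: le_trans; exact: entry_le_norm.
Qed.

End MatrixNorm.

Section QuadraticForms.
Variable R : realType.

Definition dot n (x y : 'cV[R]_n) : R := (x^T *m y) 0 0.

Lemma dotE n (x y : 'cV[R]_n) : dot x y = \sum_i x i 0 * y i 0.
Proof. by rewrite /dot mxE; apply: eq_bigr => i _; rewrite mxE. Qed.

Lemma dotDl n (x y z : 'cV[R]_n) : dot (x + y) z = dot x z + dot y z.
Proof. by rewrite /dot raddfD/= mulmxDl mxE. Qed.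

Lemma dotC n (x y : 'cV[R]_n) : dot x y = dot y x.
Proof. by rewrite !dotE; apply: eq_bigr => i _; rewrite mulrC. Qed.

Lemma dotNl n (x y : 'cV[R]_n) : dot (- x) y = - dot x y.
Proof. by rewrite /dot raddfN/= mulNmx mxE. Qed.

Lemma dotNr n (x y : 'cV[R]_n) : dot x (- y) = - dot x y.
Proof. by rewrite /dot mulmxN mxE. Qed.

Lemma dot_mulmxr m n (X : 'M[R]_(m, n)) x y : dot x (X *m y) = dot (X^T *m x) y.
Proof. by rewrite /dot trmx_mul trmxK mulmxA. Qed.

Lemma qformE n (S : 'M[R]_n) x : qform S x = dot x (S *m x).
Proof. by rewrite /qform /dot mulmxA. Qed.

(** No symmetry of [S] is assumed, hence [S + S^T] in the cross term. *)
Lemma qformD n (S : 'M[R]_n) x y :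
  qform S (x + y) = qform S x + dot ((S + S^T) *m x) y + qform S y.
Proof.
have -> : qform S (x + y) = qform S x + (x^T *m S *m y) 0 0 +
    ((y^T *m S *m x) 0 0 + qform S y).
  by rewrite /qform (linearD (@trmx R n 1)) !mulmxDl !mulmxDr !mxE.
rewrite !addrA; congr (_ + _); rewrite -addrA; congr (_ + _).
rewrite mulmxDl dotDl addrC; congr (_ + _); last first.
  by rewrite /dot trmx_mul trmxK.
rewrite /dot trmx_mul; transitivity ((y^T *m S *m x)^T 0 0).
  by rewrite [in RHS]mxE.
by rewrite !trmx_mul trmxK mulmxA.
Qed.

Lemma qform0 n (S : 'M[R]_n) : qform S 0 = 0.
Proof. by rewrite /qform mulmx0 mxE. Qed.

Lemma qformN n (S : 'M[R]_n) x : qform S (- x) = qform S x.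
Proof. by rewrite /qform mulmxN (linearN (@trmx R n 1)) !mulNmx opprK. Qed.

Lemma qform_mulmx m n (S : 'M[R]_m) (X : 'M[R]_(m, n)) x :
  qform S (X *m x) = qform (X^T *m S *m X) x.
Proof. by rewrite /qform trmx_mul !mulmxA. Qed.

Lemma qform_addmx n (S T : 'M[R]_n) x : qform (S + T) x = qform S x + qform T x.
Proof. by rewrite /qform mulmxDr mulmxDl mxE. Qed.

Lemma qform_submx n (S T : 'M[R]_n) x : qform (S - T) x = qform S x - qform T x.
Proof. by rewrite /qform mulmxBr mulmxBl !mxE. Qed.

Lemma norm_qform_le n (S : 'M[R]_n) x :
  `|qform S x| <= n%:R ^+ 2 * `|S| * `|x| ^+ 2.
Proof.
rewrite /qform (le_trans (entry_le_norm _ _ _))//.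
rewrite (le_trans (norm_mulmx_le _ _))//.
rewrite (_ : n%:R ^+ 2 * _ * _ = n%:R * (n%:R * `|x| * `|S|) * `|x|);
  last by ring.
apply: ler_wpM2r => //; apply: ler_wpM2l => //.
by rewrite (le_trans (norm_mulmx_le _ _))// !ler_pM// ?norm_trmx_le// !mulr_ge0.
Qed.

Lemma norm_dot_le n (x y : 'cV[R]_n) : `|dot x y| <= n%:R * `|x| * `|y|.
Proof.
rewrite (le_trans (entry_le_norm _ _ _))// (le_trans (norm_mulmx_le _ _))//.
by rewrite !ler_pM ?norm_trmx_le ?mulr_ge0.
Qed.

Lemma pd_ge0 n (S : 'M[R]_n) x : pd S -> 0 <= qform S x.
Proof.
move=> [_ pS]; have [->|/pS/ltW//] := eqVneq x 0; by rewrite qform0.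
Qed.

Lemma pd_unitmx n (S : 'M[R]_n) : pd S -> S \in unitmx.
Proof.
move=> [ST pS]; rewrite -row_free_unit -kermx_eq0;
  apply/rowV0P => v /sub_kermxP vS.
apply/eqP; apply: contraT => v0; have : v^T != 0 by rewrite trmx_eq0.
by move=> /pS; rewrite /qform trmxK vS mul0mx mxE ltxx.
Qed.

(** Coercivity of a positive definite form, by Cauchy-Schwarz for the inner
  product of [S]: the coordinate [x i 0] is the product of [x] with [S^-1 e_i].
  *)
Lemma pd_coord_sqr_le n (S : 'M[R]_n) (i : 'I_n) : pd S ->
  exists2 a, 0 < a & forall x : 'cV[R]_n, (x i 0) ^+ 2 <= a * qform S x.
Proof.
move=> pS; have uS := pd_unitmx pS;
  pose y : 'cV[R]_n := invmx S *m delta_mx i 0.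
have Sy : S *m y = delta_mx i 0 by rewrite mulKVmx.
have y0 : y != 0.
  apply: contraTneq isT => yE; move/matrixP/(_ i 0) : Sy.
  by rewrite yE mulmx0 !mxE !eqxx => /eqP; rewrite eq_sym oner_eq0.
exists (qform S y) => [|x]; first exact: pS.2.
have ay : 0 < qform S y by exact: pS.2.
set a := qform S y in ay *.
(* the minimiser of the form on the line through x in the direction y *)
pose t := x i 0 / a.
have := pd_ge0 (x + (- t) *: y) pS.
rewrite qformD pS.1 mulmxDl dotDl.
have -> : dot (S *m x) ((- t) *: y) = - (t * x i 0).
  rewrite -[in LHS]pS.1 -dot_mulmxr -scalemxAr Sy dotE (bigD1 i)//= big1 =>
    [|j ji].
    by rewrite !mxE !eqxx mulr1 addr0 mulrN mulrC.
  by rewrite !mxE (negPf ji) mulr0 mulr0.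
have -> : qform S ((- t) *: y) = t ^+ 2 * a.
  have yT : ((- t) *: y)^T = (- t) *: y^T by apply/matrixP => k l; rewrite !mxE.
  by rewrite /qform yT -scalemxAr -!scalemxAl scalerA mxE mulrNN -expr2.
have tE : t * a = x i 0 by rewrite /t divfK ?gt_eqF.
by rewrite -tE => H; have := mulr_ge0 (ltW ay) H; nra.
Qed.

End QuadraticForms.

Section Riccati.
Variables (R : realType) (nx nu : nat).
Variables (A : 'M[R]_nx) (B : 'M[R]_(nx, nu)).
Variables (Q P : 'M[R]_nx) (Rw : 'M[R]_nu) (K : 'M[R]_(nu, nx)).
Hypothesis hR : pd Rw.
Hypothesis hP : pd P.
Hypothesis hRiccati :
  P = Q + A^T *m P *m A - K^T *m (Rw + B^T *m P *m B) *m K.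
Hypothesis hK : K = - (invmx (Rw + B^T *m P *m B) *m B^T *m P *m A).

Let S := Rw + B^T *m P *m B.

Lemma riccati_weight_pd : pd S.
Proof.
split; first by rewrite /S raddfD/= !trmx_mul trmxK hR.1 hP.1 mulmxA.
move=> x x0; rewrite /S qform_addmx -qform_mulmx.
by rewrite ltr_wpDr ?pd_ge0// hR.2.
Qed.

Lemma gainE : S *m K = - (B^T *m P *m A).
Proof.
rewrite hK -/S mulmxN -!(mulmxA (invmx S)) mulKVmx//.
exact: pd_unitmx riccati_weight_pd.
Qed.

(** The feedback [K x] minimises the left-hand side over [u], because [S K = -
  B^T P A] cancels the cross terms; what remains is the value [x^T P x] and the
  deviation from the minimiser. *)
Lemma riccati_completion x u :
  qform Q x + qform Rw u + qform P (A *m x + B *m u) =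
  qform P x + qform S (u - K *m x).
Proof.
have PT := hP.1.
have SE : qform S u = qform Rw u + qform P (B *m u).
  by rewrite /S qform_addmx -qform_mulmx.
have PE : qform P x = qform Q x + qform P (A *m x) - qform S (K *m x).
  by rewrite {1}hRiccati qform_submx qform_addmx -!qform_mulmx.
move: SE PE gainE riccati_weight_pd.1; move: (S) => T SE PE TK TT.
rewrite PE [in RHS]qformD qformD qformN SE.
rewrite PT TT !mulmxDl !dotDl dotNr.
have -> : dot (T *m u) (K *m x) = - dot (P *m (A *m x)) (B *m u).
  rewrite dotC dot_mulmxr TT mulmxA TK mulNmx dotNl; congr (- _).
  by rewrite [RHS]dot_mulmxr !mulmxA.
by ring.
Qed.

(** [P] solves the Lyapunov equation of the closed loop [A + B K]: this makes
  sums of stage costs telescope. *)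
Lemma riccati_closed_loop x :
  qform (Q + K^T *m Rw *m K) x = qform P x - qform P ((A + B *m K) *m x).
Proof.
have := riccati_completion x (K *m x); rewrite subrr qform0 addr0 => <-.
by rewrite mulmxDl -(mulmxA B K x) addrK qform_addmx -qform_mulmx.
Qed.

End Riccati.

(** * Powers of Schur stable matrices *)

Section SchurStability.
Variable R : realType.

Lemma perturbed_contraction_cvg0 (q : R) (r b : nat -> R) :
  0 <= q < 1 -> (forall k, 0 <= r k) -> (forall k, r k.+1 <= q * r k + b k) ->
  b @ \oo --> 0 -> r @ \oo --> 0.
Proof.
move=> /andP[q0 q1] r0 rS b0; apply/cvgr0Pnorm_le => e e0.
have e' : 0 < e / 2 * (1 - q) by rewrite mulr_gt0 ?divr_gt0 ?subr_gt0.
have /cvgr0Pnorm_le/(_ _ e')[k0 _ bk0] := b0.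
have rj j : r (j + k0)%N <= q ^+ j * r k0 + e / 2.
  elim: j => [|j IH]; first by rewrite add0n expr0 mul1r lerDl ltW// divr_gt0.
  rewrite addSn (le_trans (rS _))// exprS -mulrA.
  have := bk0 (j + k0)%N (leq_addl _ _); rewrite ler_norml => /andP[_ bj].
  have := ler_wpM2l q0 IH; rewrite mulrDr => rj; nra.
have qj0 : (fun j => q ^+ j * r k0) @ \oo --> 0.
  by rewrite -[0](mul0r (r k0)); apply: cvgMl; apply: cvg_expr;
    rewrite ger0_norm.
have /cvgr0Pnorm_le/(_ (e / 2))[|j0 _ qj] := qj0; first by rewrite divr_gt0.
exists (j0 + k0)%N => // k /= j0k; rewrite ger0_norm//.
have kE : (k = (k - k0) + k0)%N
  by rewrite subnK// (leq_trans (leq_addl _ _) j0k).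
rewrite kE (le_trans (rj _))//.
have /qj : (j0 <= k - k0)%N
  by rewrite leq_subRL ?(leq_trans (leq_addl _ _) j0k)// addnC.
by rewrite ler_norml => /andP[_]; lra.
Qed.

Local Notation C := (complex R).
Local Notation normc := (@Normc.normc R).

Lemma normcE (z : C) : `|z| = (real_complex R (normc z)).
Proof. by case: z. Qed.

(** Induction on the factors: [M' = (A - z) M] is annihilated by the other
  factors, so [A^k M'] tends to 0, and [A^(k+1) M = z A^k M + A^k M'] is a
  scalar contraction with a vanishing perturbation in each entry. This replaces
  the Jordan form. *)
Lemma annihilated_powers_cvg0 n (A : 'M[C]_n) (s : seq C) (M : 'M[C]_n) :
  (forall z, z \in s -> normc z < 1) ->
  (\prod_(z <- s) (A - z%:M)) *m M = 0 ->
  forall i j, (fun k => normc ((A ^+ k *m M) i j)) @ \oo --> 0.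
Proof.
elim/last_ind: s M => [|s z IH] M s1.
  rewrite big_nil mul1mx => -> i j;
    under eq_fun do rewrite mulmx0 mxE Normc.normc0.
  exact: cvg_cst.
rewrite big_rcons/= -mulmxA => /IH cvgs i j.
apply: (@perturbed_contraction_cvg0 (normc z) _
  (fun k => normc ((A ^+ k *m ((A - z%:M) *m M)) i j))) => //.
- rewrite s1 ?mem_rcons ?mem_head// andbT.
  by case: z {s1 cvgs} => a b; rewrite sqrtr_ge0.
- by move=> k; case: (_ i j) => a b; rewrite sqrtr_ge0.
- move=> k; rewrite -Normc.normcM.
  have -> : (A ^+ k.+1 *m M) i j =
      z * (A ^+ k *m M) i j + (A ^+ k *m ((A - z%:M) *m M)) i j.
    rewrite mulmxBl mulmxBr mulmxA -[A ^+ k *m A]/(A ^+ k * A) -exprSr.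
    rewrite mul_scalar_mx -scalemxAr.
    have subE (X Y : 'M[C]_n) : (X - z *: Y) i j = X i j - z * Y i j.
      by rewrite !mxE.
    by rewrite subE addrC subrK.
  exact: le_normcD.
- apply: cvgs => y ys; apply: s1; by rewrite mem_rcons inE ys orbT.
Qed.

(** By Cayley-Hamilton, [A] is annihilated by the product of the [A - z] over
  its complex eigenvalues [z]. *)
Lemma schur_stable_powers_cvg0 n (A : 'M[R]_n) :
  schur_stable A -> (fun k => A ^+ k) @ \oo --> (0 : 'M[R]_n).
Proof.
move=> sA; apply/cvg_mx0P => i j.
case: n => [|n] in A sA i j *; first by case: i.
pose AC := map_mx (real_complex R) A.
have [s sE] := closed_field_poly_normal (char_poly AC).
have annih : (\prod_(z <- s) (AC - z%:M)) *m 1%:M = 0.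
  have := Cayley_Hamilton AC;
    rewrite {1}sE (monicP (char_poly_monic _)) scale1r.
  rewrite rmorph_prod/= mulmx1 => CH;
    transitivity (\prod_(z <- s) horner_mx AC ('X - z%:P)) => //.
  apply: eq_bigr => z _.
  by rewrite rmorphB/= horner_mx_X horner_mx_C.
have s1 z : z \in s -> normc z < 1.
  move=> zs; have : eigenvalue AC z.
    rewrite eigenvalue_root_char sE (monicP (char_poly_monic _)) scale1r.
    by rewrite root_prod_XsubC.
  by move=> /sA; rewrite normcE ltcE/= => /andP[_].
have /(_ i j) := annihilated_powers_cvg0 s1 annih.
move=> /cvgr0Pnorm_le cvgAC; apply/cvgr0Pnorm_le => e /cvgAC.
apply: filterS => k; apply: le_trans; rewrite mulmx1.
by rewrite /AC -rmorphXn/= mxE/= expr0n/= addr0 sqrtr_sqr normr_id.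
Qed.

(** Stability enters only through [F ^+ m]: over a block of fixed length the
  perturbations may be amplified by a constant, which their size compensates. *)
Lemma contraction_block n (F : 'M[R]_n) (y r : nat -> 'cV[R]_n) (e : R) m :
  (forall j, y j.+1 = F *m y j + r j) -> (forall j, (j < m)%N -> `|r j| <= e) ->
  `|y m - F ^+ m *m y 0%N| <= (\sum_(j < m) (n%:R * `|F|) ^+ j) * e.
Proof.
move=> yS; elim: m => [|m IH] re.
  by rewrite expr0 mul1mx subrr normr0 big_ord0 mul0r.
rewrite yS exprS -[F * F ^+ m]/(F *m F ^+ m) -mulmxA addrAC -mulmxBr.
rewrite (le_trans (ler_normD _ _))// big_ord_recl expr0 mulrDl mul1r addrC.
apply: lerD; first exact: re.
have {}IH := IH (fun j jm => re j (ltnW jm)).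
have Fn0 : 0 <= n%:R * `|F| by rewrite mulr_ge0.
rewrite (le_trans (norm_mulmx_le _ _))// (le_trans (ler_wpM2l Fn0 IH))//.
rewrite mulrA mulr_sumr; apply: ler_wpM2r.
  exact: le_trans (normr_ge0 _) (re m (ltnSn m)).
by apply: ler_sum => j _; rewrite exprS.
Qed.

End SchurStability.

(** * The Minkowski series *)

Section MinkowskiSeries.
Variables (R : realType) (n m : nat) (F : 'M[R]_n) (D : 'M[R]_(n, m)).
Implicit Types W : set 'cV[R]_m.

Lemma lin_trajE x u k :
  lin_traj F D x u k =
  F ^+ k *m x + \sum_(j < k) F ^+ j *m D *m u (k.-1 - j)%N.
Proof.
elim: k => [|k IH] /=; first by rewrite expr0 big_ord0 addr0 mul1mx.
rewrite IH mulmxDr mulmxA -[F *m F ^+ k]/(F * F ^+ k) -exprS -addrA.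
congr (_ + _); rewrite big_ord_recl/= expr0 mul1mx subn0 addrC; congr (_ + _).
rewrite mulmx_sumr; apply: eq_bigr => j _; rewrite /bump/= add1n.
by rewrite !mulmxA -[F *m F ^+ j]/(F * F ^+ j) -exprS subnS predn_sub.
Qed.

Lemma lin_trajE_rev x u k :
  lin_traj F D x u k =
  F ^+ k *m x + \sum_(j < k) (F ^+ (k.-1 - j)%N *m D) *m u j.
Proof.
rewrite lin_trajE; congr (_ + _); rewrite [RHS](reindex_inj rev_ord_inj)/=.
by apply: eq_bigr => -[j jk] _ /=;
  rewrite subnS predn_sub subKn// -ltnS prednK// (leq_ltn_trans _ jk).
Qed.

(** Put the new disturbance in front of the sequence. *)
Lemma minkowski_series_step W x dist :
  minkowski_series F D W x -> W dist ->
  minkowski_series F D W (F *m x + D *m dist).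
Proof.
move=> [w [wW wx]] Wd; exists (fun j => if j is i.+1 then w i else dist).
split; first by case.
rewrite -(cvg_shiftS (series _)) /=.
have -> : (fun k => series (fun j => F ^+ j *m D *m
      match j with 0 => dist | i.+1 => w i end) k.+1) =
    (fun k => F *m series (fun j => F ^+ j *m D *m w j) k + D *m dist).
  apply/funext => k; rewrite /series/= big_nat_recl//= expr0 mul1mx addrC.
  congr (_ + _); rewrite mulmx_sumr; apply: eq_bigr => j _.
  by rewrite exprS !mulmxA.
apply: cvgD; last exact: cvg_cst.
apply/cvgrPdist_le => e e0.
have c0 : 0 < n%:R * `|F| + 1 by rewrite ltr_wpDl ?mulr_ge0.
have /cvgrPdist_le/(_ (e / (n%:R * `|F| + 1)))[|k0 _ H] := wx;
  first exact: divr_gt0.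
exists k0 => // k /H; rewrite -mulmxBr => {}H.
rewrite (le_trans (norm_mulmx_le _ _))//.
rewrite (le_trans (ler_wpM2l _ H)) ?mulr_ge0//.
by rewrite mulrCA ger_pMr// ler_pdivrMr// mul1r lerDl.
Qed.

(** Controllability writes each basis vector as a finite sum; the coefficients
  of a small vector scale these finitely many disturbances down into the
  neighbourhood [W]. *)
Lemma minkowski_series_ball W : controllable F D -> nbhs (0 : 'cV[R]_m) W ->
  \forall x \near (0 : 'cV[R]_n), minkowski_series F D W x.
Proof.
move=> ctr /nbhs_ballP[r /= r0 rW].
have /choice[ku H] : forall i : 'I_n, exists ku : nat * (nat -> 'cV[R]_m),
    \sum_(j < ku.1) F ^+ j *m D *m ku.2 j = delta_mx i 0.
  move=> i; have [k [u ukE]] := ctr 0 (delta_mx i 0).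
  exists (k, fun j => u (k.-1 - j)%N) => /=.
  by move: ukE; rewrite lin_trajE mulmx0 add0r.
(* pad the finite expansions with zeros up to a common length *)
pose v i j := if (j < (ku i).1)%N then (ku i).2 j else 0.
pose kmax := \max_i (ku i).1.
have vE i : \sum_(0 <= j < kmax) F ^+ j *m D *m v i j = delta_mx i 0.
  rewrite -(H i) -(big_mkord xpredT (fun j => F ^+ j *m D *m (ku i).2 j)).
  rewrite (@big_cat_nat _ _ _ (ku i).1 0 kmax)//=; last exact: leq_bigmax.
  rewrite [X in _ + X]big1_seq ?addr0; last first.
    move=> j /=; rewrite mem_index_iota => /andP[kj _];
      by rewrite /v ltnNge kj/= mulmx0.
  by apply: eq_big_nat => j /andP[_ jk]; rewrite /v jk.
pose c := \sum_i \sum_(j < kmax) `|v i j| + 1.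
have c0 : 0 < c.
  by rewrite /c ltr_wpDl// sumr_ge0// => i _; rewrite sumr_ge0.
apply/nbhs_ballP; exists (r / c) => /=; first exact: divr_gt0.
move=> x; rewrite -ball_normE/= sub0r normrN => xr.
exists (fun j => \sum_i x i 0 *: v i j); split.
  move=> j; apply: rW; rewrite -ball_normE/= sub0r normrN.
  have [jk|kj] := ltnP j kmax; last first.
    rewrite big1 ?normr0// => i _;
      rewrite /v ltnNge (leq_trans _ kj) ?scaler0//.
    exact: leq_bigmax.
  apply: le_lt_trans (_ : `|x| * c < r); last by rewrite -ltr_pdivlMr.
  rewrite (le_trans (ler_norm_sum _ _ _))//.
  rewrite /c mulrDr mulr1 -[leLHS]addr0 lerD//.
  rewrite mulr_sumr; apply: ler_sum => i _;
    rewrite normrZ ler_pM ?entry_le_norm//.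
  by rewrite (bigD1 (Ordinal jk))//= lerDl sumr_ge0.
apply: (@cvg_near_cst _ _ _ _ _ _).
exists kmax => // k /= kk; rewrite /series/=.
rewrite (@big_cat_nat _ _ _ kmax)//= [X in _ + X]big1_seq ?addr0; last first.
  move=> j /=; rewrite mem_index_iota => /andP[kj _];
    rewrite big1 ?mulmx0// => i _.
  by rewrite /v ltnNge (leq_trans _ kj) ?scaler0//; exact: leq_bigmax.
under eq_bigr do rewrite mulmx_sumr.
rewrite exchange_big/= [RHS](matrix_sum_delta x); apply: eq_bigr => i _.
rewrite big_ord_recl big_ord0 addr0 -vE scaler_sumr.
by apply: eq_bigr => j _; rewrite -scalemxAr.
Qed.

End MinkowskiSeries.

(** * Borel and bounded random vectors *)

Section BorelVectors.
Variable R : realType.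

(** The union is countable: this reduces measurability of a random vector to
  that of its coordinates. *)
Lemma open_rational_balls n (U : set 'cV[R]_n) : open U ->
  U = \bigcup_(p in [set p : 'cV[rat]_n * nat |
         ball (map_mx ratr p.1 : 'cV[R]_n) p.2.+1%:R^-1 `<=` U])
       ball (map_mx ratr p.1 : 'cV[R]_n) p.2.+1%:R^-1.
Proof.
move=> oU; apply/seteqP; split=> [x Ux|x [p pU]]; last exact: pU.
have /nbhs_ballP[e /= e0 xeU] : nbhs x U by exact: open_nbhs_nbhs.
have [k ke] : exists k : nat, k.+1%:R^-1 < e / 2.
  have /cvgr0Pnorm_lt/(_ _ (divr_gt0 e0 (ltr0n _ 2)))[k _ H] := @cvg_harmonic R.
  by exists k; have := H k (leqnn _); rewrite /= ger0_norm.
have /choice[q xq] : forall i, exists q : rat, `|x i 0 - ratr q| < k.+1%:R^-1.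
  move=> i; have [q]
    := @rat_in_itvoo R (x i 0 - k.+1%:R^-1) (x i 0)
    ltac:(by rewrite ltrBlDr ltrDl).
  rewrite in_itv/= => /andP[q1 q2]; exists q.
  by rewrite gtr0_norm ?subr_gt0// ltrBlDr addrC -ltrBlDr.
have xq' : `|x - map_mx ratr (\col_i q i)| < k.+1%:R^-1.
  rewrite [ltLHS](mx_normrE) bigmax_lt//= => -[i j] _ /=.
  by rewrite !mxE ord1.
exists (\col_i q i, k) => /=; last first.
  by rewrite -ball_normE/= distrC.
move=> y; rewrite -ball_normE/= => qy; apply: xeU; rewrite -ball_normE/=.
rewrite (le_lt_trans (ler_distD (map_mx ratr (\col_i q i)) _ _))//.
by rewrite (splitr e) ltrD// (lt_trans _ ke).
Qed.

Lemma continuous_borel_measurable n (f : 'cV[R]_n -> R) : continuous f ->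
  measurable_fun setT (f : borel R n -> R).
Proof.
move=> cf; apply: (measurability _ (RGenOInfty.measurableE R)).
move=> _ [_ [a ->] <-]; rewrite setTI; apply: sub_sigma_algebra.
by apply: open_comp; [move=> x _; exact: cf|exact: interval_open].
Qed.

Lemma measurable_vecP d (T : measurableType d) n (X : T -> 'cV[R]_n) :
  (forall i, measurable_fun setT (fun t => X t i 0)) <->
  measurable_fun setT (X : T -> borel R n).
Proof.
split=> [mX|mX i]; last first.
  have mi : measurable_fun setT (fun x : borel R n => x i 0).
    by apply: continuous_borel_measurable; exact: coord_continuous.
  exact: (measurableT_comp mi mX).
have mE : @measurable _ (borel R n) = <<s @open 'cV[R]_n >> by [].
apply: (measurability _ mE).
move=> _ [U oU <-]; rewrite setTI (open_rational_balls oU) preimage_bigcup.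
rewrite bigcup_mkcond; apply: countable_bigcupT_measurable => [|[q k]].
  exact: countableP.
case: ifP => // _.
have -> : X @^-1` ball (map_mx ratr q : 'cV[R]_n) k.+1%:R^-1 =
    \bigcap_(i in [set: 'I_n]) (fun t => X t i 0) @^-1` ball (ratr (q i 0) : R)
      k.+1%:R^-1.
  apply/seteqP; split=> [t /= Xt i _|t /= Xt].
    move: Xt; rewrite -!ball_normE/=; apply: le_lt_trans.
    by have := entry_le_norm (map_mx ratr q - X t) i 0; rewrite !mxE.
  rewrite -ball_normE/= [ltLHS](mx_normrE) bigmax_lt//= => -[i j] _ /=.
  by rewrite ord1 !mxE; have := Xt i I; rewrite -ball_normE.
apply: fin_bigcap_measurable => [|i _]; first exact: finite_finset.
rewrite -[_ @^-1` _]setTI; apply: mX => //.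
by apply: open_measurable; exact: ball_open.
Qed.

End BorelVectors.

Section BorelMaps.
Variables (R : realType) (d : measure_display) (T : measurableType d).

Lemma measurable_vecD n (X Y : T -> 'cV[R]_n) :
  measurable_fun setT (X : T -> borel R n) ->
    measurable_fun setT (Y : T -> borel R n) ->
  measurable_fun setT ((fun t => X t + Y t) : T -> borel R n).
Proof.
move=> /measurable_vecP mX /measurable_vecP mY; apply/measurable_vecP => i.
by under eq_fun do rewrite mxE; exact: measurable_funD.
Qed.

Lemma measurable_vec_mulmx m n (M : 'M[R]_(m, n)) (X : T -> 'cV[R]_n) :
  measurable_fun setT (X : T -> borel R n) ->
  measurable_fun setT ((fun t => M *m X t) : T -> borel R m).
Proof.
move=> /measurable_vecP mX; apply/measurable_vecP => i.
under eq_fun do rewrite mxE.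
by apply: measurable_sum => j; apply: measurable_funM.
Qed.

Lemma measurable_qform n (S : 'M[R]_n) (X : T -> 'cV[R]_n) :
  measurable_fun setT (X : T -> borel R n) ->
  measurable_fun setT (fun t => qform S (X t)).
Proof.
move=> mX; have /measurable_vecP mSX := measurable_vec_mulmx S mX.
move/measurable_vecP in mX; under eq_fun do rewrite qformE dotE.
by apply: measurable_sum => i; exact: measurable_funM.
Qed.

End BorelMaps.

Section BoundedRandomVectors.
Variables (R : realType) (d : measure_display) (T : measurableType d).
Implicit Types f g : T -> R.

(** Expectations are only taken of bounded random variables, for which
  integrability is automatic. The measurable structure varies: it is that of the
  whole space or that of the past of some time. *)
Definition bounded_rv f :=
  measurable_fun setT f /\ exists C, forall t, `|f t| <= C.

Lemma bounded_rv_cst c : bounded_rv (fun=> c).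
Proof. by split => //; exists `|c|. Qed.

Lemma bounded_rvD f g :
  bounded_rv f -> bounded_rv g -> bounded_rv (fun t => f t + g t).
Proof.
move=> [mf [a fa]] [mg [b gb]]; split; first exact: measurable_funD.
by exists (a + b) => t; rewrite (le_trans (ler_normD _ _))// lerD.
Qed.

Lemma bounded_rvM f g :
  bounded_rv f -> bounded_rv g -> bounded_rv (fun t => f t * g t).
Proof.
move=> [mf [a fa]] [mg [b gb]]; split; first exact: measurable_funM.
by exists (a * b) => t; rewrite normrM ler_pM.
Qed.

Lemma bounded_rvN f : bounded_rv f -> bounded_rv (fun t => - f t).
Proof.
move=> bf; rewrite (_ : (fun t => - f t) = fun t => -1 * f t).
  by apply: bounded_rvM => //; exact: bounded_rv_cst.
by apply/funext => t; rewrite mulN1r.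
Qed.

Lemma bounded_rv_sum I (r : seq I) (P : pred I) (F : I -> T -> R) :
  (forall i, P i -> bounded_rv (F i)) ->
  bounded_rv (fun t => \sum_(i <- r | P i) F i t).
Proof.
move=> bF; elim: r => [|i r IH].
  under eq_fun do rewrite big_nil; exact: bounded_rv_cst.
under eq_fun do rewrite big_cons.
by case Pi: (P i) => //; apply: bounded_rvD IH; exact: bF.
Qed.

Definition bounded_rvec n (X : T -> 'cV[R]_n) :=
  forall i, bounded_rv (fun t => X t i 0).

Lemma bounded_rvec_cst n (x : 'cV[R]_n) : bounded_rvec (fun=> x).
Proof. by move=> i; exact: bounded_rv_cst. Qed.

Lemma bounded_rvecD n (X Y : T -> 'cV[R]_n) :
  bounded_rvec X -> bounded_rvec Y -> bounded_rvec (fun t => X t + Y t).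
Proof.
by move=> bX bY i; under eq_fun do rewrite mxE; exact: bounded_rvD.
Qed.

Lemma bounded_rvecN n (X : T -> 'cV[R]_n) :
  bounded_rvec X -> bounded_rvec (fun t => - X t).
Proof.
by move=> bX i; under eq_fun do rewrite mxE; exact: bounded_rvN.
Qed.

Lemma bounded_rvec_mulmx m n (M : 'M[R]_(m, n)) (X : T -> 'cV[R]_n) :
  bounded_rvec X -> bounded_rvec (fun t => M *m X t).
Proof.
move=> bX i; under eq_fun do rewrite mxE.
by apply: bounded_rv_sum => k _; apply: bounded_rvM (bX k);
  exact: bounded_rv_cst.
Qed.

Lemma bounded_rvec_sum n I (r : seq I) (P : pred I) (F : I -> T -> 'cV[R]_n) :
  (forall i, P i -> bounded_rvec (F i)) ->
  bounded_rvec (fun t => \sum_(i <- r | P i) F i t).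
Proof.
by move=> bF j; under eq_fun do rewrite summxE; apply: bounded_rv_sum => i /bF.
Qed.

Lemma bounded_rv_dot n (X Y : T -> 'cV[R]_n) :
  bounded_rvec X -> bounded_rvec Y -> bounded_rv (fun t => dot (X t) (Y t)).
Proof.
move=> bX bY; under eq_fun do rewrite dotE.
by apply: bounded_rv_sum => i _; exact: bounded_rvM.
Qed.

Lemma bounded_rv_qform n (S : 'M[R]_n) (X : T -> 'cV[R]_n) :
  bounded_rvec X -> bounded_rv (fun t => qform S (X t)).
Proof.
move=> bX; under eq_fun do rewrite qformE.
by apply: bounded_rv_dot => //; exact: bounded_rvec_mulmx.
Qed.

Lemma bounded_rvecI n (X : T -> 'cV[R]_n) C :
  measurable_fun setT (X : T -> borel R n) -> (forall t, `|X t| <= C) ->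
  bounded_rvec X.
Proof.
move=> /measurable_vecP mX XC i; split; first exact: mX.
by exists C => t; apply: le_trans (entry_le_norm _ _ _) (XC t).
Qed.

End BoundedRandomVectors.

Section Expectation.
Variables (R : realType) (d : measure_display) (T : measurableType d).
Variable Pr : probability T R.
Implicit Types f g : T -> R.

(** The real-valued expectation, used for bounded random variables only. *)
Definition Ex f : R := fine ('E_Pr[f]).

Lemma bounded_rv_integrable f : bounded_rv f -> Pr.-integrable setT (EFin \o f).
Proof.
move=> [mf [C fC]]; apply: (@measurable_bounded_integrable _ _ _ Pr).
- by [].
- by rewrite (le_lt_trans (probability_le1 _ _))// ltry.
- exact: mf.
- exists C; split; first exact: num_real.
  by move=> x Cx t _; exact: le_trans (fC t) (ltW Cx).
Qed.

Lemma expectation_Ex f : bounded_rv f -> ('E_Pr[f] = (Ex f)%:E)%E.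
Proof.
move=> /bounded_rv_integrable fi; rewrite /Ex fineK//.
by rewrite unlock; exact: integrable_fin_num.
Qed.

Lemma integral_Ex f : bounded_rv f -> (\int[Pr]_t (f t)%:E = (Ex f)%:E)%E.
Proof. by move=> /expectation_Ex <-; rewrite unlock. Qed.

Lemma ExD f g : bounded_rv f -> bounded_rv g ->
  Ex (fun t => f t + g t) = Ex f + Ex g.
Proof.
move=> bf bg; apply: EFin_inj; rewrite EFinD -!expectation_Ex ?unlock//;
  last exact: bounded_rvD.
by rewrite integralD_EFin//; exact: bounded_rv_integrable.
Qed.

Lemma Ex_cst c : Ex (fun=> c) = c.
Proof. by rewrite /Ex (expectation_cst Pr c). Qed.

Lemma ExM c f : bounded_rv f -> Ex (fun t => c * f t) = c * Ex f.
Proof.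
move=> bf; apply: EFin_inj; rewrite EFinM -!expectation_Ex ?unlock//;
  last first.
  by apply: bounded_rvM => //; exact: bounded_rv_cst.
under eq_integral do rewrite EFinM.
by rewrite integralZl//; exact: bounded_rv_integrable.
Qed.

Lemma ExN f : bounded_rv f -> Ex (fun t => - f t) = - Ex f.
Proof.
by move=> bf; rewrite -mulN1r -ExM//; congr Ex; apply/funext => t;
  rewrite mulN1r.
Qed.

Lemma Ex_sum I (r : seq I) (P : pred I) (F : I -> T -> R) :
  (forall i, P i -> bounded_rv (F i)) ->
  Ex (fun t => \sum_(i <- r | P i) F i t) = \sum_(i <- r | P i) Ex (F i).
Proof.
move=> bF; elim: r => [|i r IH].
  by rewrite big_nil; under eq_fun do rewrite big_nil; exact: Ex_cst.
rewrite big_cons; under eq_fun do rewrite big_cons.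
case Pi: (P i) => //; rewrite ExD ?IH//; [exact: bF|exact: bounded_rv_sum].
Qed.

Lemma Ex_le f g : bounded_rv f -> bounded_rv g -> (forall t, f t <= g t) ->
  Ex f <= Ex g.
Proof.
move=> bf bg fg; rewrite -lee_fin -!expectation_Ex// unlock.
apply: le_integral => //; [exact: bounded_rv_integrable..|].
by move=> t _; rewrite lee_fin.
Qed.

Lemma Ex_ge0 f : bounded_rv f -> (forall t, 0 <= f t) -> 0 <= Ex f.
Proof.
by move=> bf f0; rewrite -(Ex_cst 0); apply: Ex_le => //; exact: bounded_rv_cst.
Qed.

End Expectation.

(** * Independence of the past *)

Section Independence.
Variables (R : realType) (d : measure_display) (Omega : measurableType d).
Variables (Pr : probability Omega R) (n : nat) (w : nat -> Omega -> 'cV[R]_n).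
Hypothesis hw : iid Pr w.

(** A pi-system that generates the sigma-algebra of [w 0, ..., w (k - 1)]. *)
Definition past_cylinders k : set (set Omega) :=
  [set F | exists E : nat -> set (borel R n), (forall j, measurable (E j)) /\
     F = \bigcap_(j in [set j | (j < k)%N]) w j @^-1` E j].

(** The sample space with the sigma-algebra of the disturbances before time [k];
  measurability on it expresses adaptedness. *)
Definition past k := g_sigma_algebraType (past_cylinders k).

Lemma measurable_noise k : measurable_fun setT (w k : Omega -> borel R n).
Proof. by case: hw. Qed.

Lemma past_cylinders_setI k : setI_closed (past_cylinders k).
Proof.
move=> _ _ [E [mE ->]] [F [mF ->]]; exists (fun j => E j `&` F j); split.
  by move=> j; exact: measurableI.
by rewrite -bigcapI.
Qed.

Lemma past_cylinders_measurable k : past_cylinders k `<=` measurable.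
Proof.
move=> _ [E [mE ->]]; apply: fin_bigcap_measurable => [|j _];
  first exact: finite_II.
by rewrite -[X in measurable X]setTI; apply: measurable_noise.
Qed.

Lemma past_measurable k (A : set Omega) :
  measurable (A : set (past k)) -> measurable A.
Proof.
apply: smallest_sub => //; last exact: past_cylinders_measurable.
exact: sigma_algebra_measurable.
Qed.

Lemma measurable_past_le j k (A : set Omega) : (j <= k)%N ->
  measurable (A : set (past j)) -> measurable (A : set (past k)).
Proof.
move=> jk; apply: smallest_sub; first exact: smallest_sigma_algebra.
move=> _ [E [mE ->]]; apply: sub_sigma_algebra.
exists (fun i => if (i < j)%N then E i else setT); split=> [i|].
  by case: ifP.
apply/seteqP; split=> [om wE i /= _|om wE i /= ij].
  by case: ifP => // /wE.
by have := wE i (leq_trans ij jk); rewrite ij.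
Qed.

Lemma noise_past_measurable j k : (j < k)%N ->
  measurable_fun setT (w j : past k -> borel R n).
Proof.
move=> jk _ E mE; rewrite setTI; apply: sub_sigma_algebra.
exists (fun i => if i == j then E else setT); split=> [i|].
  by case: ifP.
apply/seteqP; split=> [om wE i /= ik|om /(_ j jk)]; last by rewrite eqxx.
by case: eqP => // ->.
Qed.

(** Both sides are finite measures in [A] that agree on the pi-system of
  cylinders. *)
Lemma past_noise_indep k (A : set Omega) (E : set (borel R n)) :
  measurable (A : set (past k)) -> measurable E ->
  Pr (A `&` w k @^-1` E) = (Pr A * Pr (w k @^-1` E))%E.
Proof.
move=> mA mE.
have mwE : measurable (w k @^-1` E).
  by rewrite -[X in measurable X]setTI; apply: measurable_noise.
have PwE : (fine (Pr (w k @^-1` E)))%:E = Pr (w k @^-1` E).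
  by rewrite fineK// fin_num_measure.
have r0 : 0 <= fine (Pr (w k @^-1` E)) by exact: fine_ge0.
transitivity (mscale (NngNum r0) Pr A); last by rewrite /mscale/= PwE muleC.
rewrite -[LHS]/(mrestr Pr mwE A).
have [_ indep _] := hw.
apply: (g_sigma_algebra_measure_unique (past_cylinders k) _ (fun=> setT)) => //.
- exact: past_cylinders_measurable.
- move=> _; exists (fun=> setT); split => //.
  by rewrite bigcapT.
- by rewrite bigcup_const.
- exact: past_cylinders_setI.
- move=> _ [F [mF ->]].
  have := indep [fset j in iota 0 k.+1]%fset
    (fun j => if j == k then E else F j).
  have := indep [fset j in iota 0 k]%fset F mF.
  have capE (G : nat -> set (borel R n)) m :
      \bigcap_(i in [set` [fset j in iota 0 m]%fset]) (w i @^-1` G i) =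
      \bigcap_(i in [set i | (i < m)%N]) w i @^-1` G i.
    apply/seteqP; split=> om wG i /= im; apply: wG => /=; move: im;
      by rewrite inE/= mem_iota add0n.
  have prodE (G : nat -> set (borel R n)) m :
      (\prod_(i <- [fset j in iota 0 m]%fset) Pr (w i @^-1` G i) =
       \prod_(i <- iota 0 m) Pr (w i @^-1` G i))%E.
    apply: perm_big; apply: uniq_perm; [exact: fset_uniq|exact: iota_uniq|].
    by move=> i; rewrite inE.
  rewrite !capE !prodE => indepk indepF.
  rewrite -[RHS]/((fine (Pr (w k @^-1` E)))%:E * Pr _)%E PwE indepk.
  have mEF j : measurable (if j == k then E else F j) by case: ifP.
  have {indepF} := indepF mEF.
  rewrite -addn1 iotaD/= add0n big_cat/= big_seq1 eqxx muleC => indepF.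
  transitivity (Pr (\bigcap_(i in [set i | (i < k + 1)%N])
      w i @^-1` (if i == k then E else F i))).
    congr (Pr _); apply/seteqP; split=> [om [wF wE] i /= |om wEF].
      by rewrite addn1 ltnS leq_eqVlt; case: eqP => [->//|_ /= /wF].
    split=> [i ik|]; last by have := wEF k; rewrite /= addn1 ltnSn eqxx; exact.
    by have := wEF i; rewrite /= addn1 ltnS ltnW// ltn_eqF//; exact.
  rewrite [LHS]indepF; congr (_ * _)%E; rewrite !big_seq; apply: eq_bigr => i.
  by rewrite mem_iota add0n => /andP[_ ik]; rewrite ltn_eqF.
- move=> _; exact:
  (le_lt_trans (probability_le1 Pr (measurableI _ _ measurableT mwE)) (ltry _)).
Qed.

Section Freezing.
Variables (d' : measure_display) (T : measurableType d') (X : Omega -> T)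
  (k : nat).
Hypothesis mX : measurable_fun setT (X : past k -> T).

Lemma past_measurable_fun : measurable_fun setT X.
Proof.
by move=> _ E mE; rewrite setTI; apply: (@past_measurable k);
  rewrite -[X in measurable X]setTI; exact: mX.
Qed.

(** The law of the pair of [X] and [w k] is the product of their laws, so
  Tonelli allows integrating over a fresh copy of the disturbance while the past
  is frozen. *)
Lemma freezing (F : T * borel R n -> \bar R) :
  measurable_fun setT F -> (forall x, 0 <= F x)%E ->
  (\int[Pr]_om F (X om, w k om) =
   \int[Pr]_om \int[Pr]_om' F (X om, w 0%N om'))%E.
Proof.
move=> mF F0; have [mw _ ident] := hw.
pose X' : {RV Pr >-> T} := mfun_Sub (mem_set past_measurable_fun).
pose w0 : {RV Pr >-> borel R n} := mfun_Sub (mem_set (mw 0%N)).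
have mphi : measurable_fun setT (fun om => (X om, w k om : borel R n)).
  by apply: measurable_fun_pair => //; exact: past_measurable_fun.
pose phi : {RV Pr >-> (T * borel R n)%type} := mfun_Sub (mem_set mphi).
transitivity (\int[distribution Pr phi]_y F y)%E.
  by rewrite ge0_integral_distribution.
rewrite (eq_measure_integral (distribution Pr X' \x distribution Pr w0)%E).
  rewrite fubini_tonelli1// ge0_integral_distribution//.
  - apply: eq_integral => om _; rewrite /fubini_F/= ge0_integral_distribution//.
    by apply: measurableT_comp.
  - exact: measurable_fun_fubini_tonelli_F.
  - by move=> x; rewrite /fubini_F; exact: integral_ge0.
move=> A mA _; apply/esym; apply: product_measure_unique => // A1 A2 mA1 mA2.
transitivity (Pr (X @^-1` A1) * Pr (w k @^-1` A2))%E.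
  by apply: past_noise_indep => //; rewrite -[X in measurable X]setTI;
    exact: mX.
by congr (_ * _)%E; exact: ident.
Qed.

End Freezing.

Lemma bounded_rv_past j k (f : Omega -> R) : (j <= k)%N ->
  bounded_rv (f : past j -> R) -> bounded_rv (f : past k -> R).
Proof.
move=> jk [mf bf]; split=> // _ E mE; rewrite setTI.
apply: (measurable_past_le jk).
by rewrite -[X in measurable X]setTI; exact: mf.
Qed.

Lemma bounded_rv_of_past k (f : Omega -> R) :
  bounded_rv (f : past k -> R) -> bounded_rv f.
Proof. by move=> [mf bf]; split => //; exact: past_measurable_fun mf. Qed.

Section NoiseFunction.
Variables (g : borel R n -> R) (C : R).
Hypotheses (mg : measurable_fun setT g) (gC : forall j om, `|g (w j om)| <= C).

Lemma bounded_rv_noise j : bounded_rv (fun om => g (w j om)).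
Proof.
by split; [exact: measurableT_comp mg (measurable_noise j)|exists C].
Qed.

(** The freezing lemma concerns nonnegative functions; adding the bounds [B] and
  [C] makes both factors nonnegative. *)
Lemma Ex_past_noise_shifted k (Y : Omega -> R) (B : R) :
  bounded_rv (Y : past k -> R) -> (forall om, `|Y om| <= B) ->
  Ex Pr (fun om => (Y om + B) * (g (w k om) + C)) =
  (Ex Pr Y + B) * (Ex Pr (fun om => g (w 0%N om)) + C).
Proof.
move=> [mY bY] YB.
have bY' : bounded_rv Y by split => //; exact: past_measurable_fun mY.
have bg := bounded_rv_noise.
(* the absolute value makes F nonnegative also off the range of (Y, w k) *)
pose F (yv : R * borel R n) : \bar R := `|(yv.1 + B) * (g yv.2 + C)|%:E.
have mF : measurable_fun setT F.
  apply/measurable_EFinP; apply: measurableT_comp => //; apply: measurable_funM.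
    by apply: measurable_funD => //; exact: measurable_cst.
  apply: measurable_funD => //.
  by apply: (measurableT_comp mg); exact: measurable_snd.
have FE om om' j : F (Y om, w j om') = ((Y om + B) * (g (w j om') + C))%:E.
  rewrite /F/= ger0_norm// mulr_ge0//.
    by have := YB om; rewrite ler_norml; lra.
  by have := gC j om'; rewrite ler_norml; lra.
have bc c : bounded_rv (fun _ : Omega => c) := bounded_rv_cst _ c.
have bgC j : bounded_rv (fun om => g (w j om) + C) by exact: bounded_rvD.
have bYB : bounded_rv (fun om => Y om + B) by exact: bounded_rvD.
have := freezing mY mF (fun _ => normr_ge0 _).
under eq_integral do rewrite FE.
under [in RHS]eq_integral => om _.
  under eq_integral do rewrite FE.
  rewrite integral_Ex ?ExM// ?ExD ?Ex_cst//; last exact: bounded_rvM.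
  rewrite mulrC; over.
rewrite !integral_Ex; [|exact: bounded_rvM..].
by rewrite ExM// ExD// Ex_cst mulrC => H; exact: EFin_inj H.
Qed.

(** The case [Y = 0], [B = 1] of the shifted product formula. *)
Lemma Ex_noise k :
  Ex Pr (fun om => g (w k om)) = Ex Pr (fun om => g (w 0%N om)).
Proof.
have b0 : bounded_rv (fun _ : past k => 0 : R) := bounded_rv_cst _ 0.
have b01 (om : Omega) : `|0 : R| <= 1 by rewrite normr0.
have := Ex_past_noise_shifted b0 b01.
rewrite (_ : (fun om => (0 + 1) * (g (w k om) + C)) = fun om => g (w k om) + C);
  last by apply/funext => om; ring.
rewrite ExD ?Ex_cst; [|exact: bounded_rv_noise|exact: bounded_rv_cst].
by rewrite add0r mul1r => /addIr.
Qed.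

Lemma Ex_past_noise k (Y : Omega -> R) : bounded_rv (Y : past k -> R) ->
  Ex Pr (fun om => Y om * g (w k om)) =
  Ex Pr Y * Ex Pr (fun om => g (w 0%N om)).
Proof.
move=> bY; have bY' := bounded_rv_of_past bY; have [_ [B YB]] := bY.
have := Ex_past_noise_shifted bY YB.
have bg := bounded_rv_noise k.
have bc c : bounded_rv (fun _ : Omega => c) := bounded_rv_cst _ c.
rewrite (_ : (fun om => (Y om + B) * (g (w k om) + C)) =
  fun om => Y om * g (w k om) + (C * Y om + (B * g (w k om) + B * C)));
    last first.
  by apply/funext => om; ring.
have bYg : bounded_rv (fun om => Y om * g (w k om)) by exact: bounded_rvM.
have bCY : bounded_rv (fun om => C * Y om) by exact: bounded_rvM.
have bBg : bounded_rv (fun om => B * g (w k om)) by exact: bounded_rvM.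
have bBg' : bounded_rv (fun om => B * g (w k om) + B * C) by exact: bounded_rvD.
rewrite !ExD ?ExM ?Ex_cst ?Ex_noise//; last exact: bounded_rvD.
by lra.
Qed.

End NoiseFunction.

End Independence.

(** * Second moments and laws of large numbers *)

Section CentredNoise.
Variables (R : realType) (d : measure_display) (Omega : measurableType d).
Variables (Pr : probability Omega R) (n : nat) (w : nat -> Omega -> 'cV[R]_n).
Hypothesis hw : iid Pr w.
Variable Cw : R.
Hypothesis wC : forall j om, `|w j om| <= Cw.
Hypothesis hmean : forall k i, ('E_Pr[fun om => w k om i ord0] = 0)%E.

Lemma bounded_rvec_noise_past j k : (j < k)%N ->
  bounded_rvec (w j : past w k -> 'cV[R]_n).
Proof.
move=> jk.
exact: (@bounded_rvecI _ _ (past w k) _ _ Cw (noise_past_measurable jk) (wC j)).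
Qed.

Lemma bounded_rvec_noise j : bounded_rvec (w j).
Proof. exact: bounded_rvecI (measurable_noise hw j) (wC j). Qed.

Lemma Ex_dot_noise k (Y : Omega -> 'cV[R]_n) :
  bounded_rvec (Y : past w k -> 'cV[R]_n) ->
  Ex Pr (fun om => dot (Y om) (w k om)) = 0.
Proof.
move=> bY; under eq_fun do rewrite dotE.
have bYi i : bounded_rv (fun om => Y om i 0) by exact:
  (bounded_rv_of_past hw (bY i)).
rewrite Ex_sum => [|i _]; last by apply: bounded_rvM => //;
  exact: bounded_rvec_noise.
rewrite big1// => i _.
have mi : measurable_fun setT (fun x : borel R n => x i 0).
  by apply: continuous_borel_measurable; exact: coord_continuous.
have iC j om : `|w j om i 0| <= Cw by apply: le_trans (wC j om);
  exact: entry_le_norm.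
rewrite (Ex_past_noise hw mi iC (bY i)).
by rewrite [X in _ * X](_ : _ = 0) ?mulr0// /Ex hmean.
Qed.

Lemma Ex_qform_noise m (S : 'M[R]_m) (L : 'M[R]_(m, n)) k :
  Ex Pr (fun om => qform S (L *m w k om)) =
  Ex Pr (fun om => qform S (L *m w 0%N om)).
Proof.
have cS : measurable_fun setT (fun v : borel R n => qform S (L *m v)).
  have mid : measurable_fun setT (id : borel R n -> borel R n) by [].
  move/measurable_vecP in mid.
  under eq_fun do rewrite qform_mulmx qformE dotE.
  apply: measurable_sum => i; apply: measurable_funM => //.
  under eq_fun do rewrite mxE.
  by apply: measurable_sum => j; apply: measurable_funM.
apply: (@Ex_noise _ _ _ _ _ _ hw (fun v => qform S (L *m v))
  (m%:R ^+ 2 * `|S| * (n%:R * `|L| * Cw) ^+ 2)) => //.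
move=> j om; rewrite (le_trans (norm_qform_le _ _))//.
apply: ler_wpM2l; first by rewrite mulr_ge0.
rewrite lerXn2r ?nnegrE// ?(le_trans (norm_mulmx_le _ _))//.
  by rewrite !mulr_ge0// (le_trans _ (wC j om)).
by apply: ler_wpM2l; rewrite ?mulr_ge0.
Qed.

(** Distinct disturbances are centred and independent, so all cross terms
  vanish. *)
Lemma Ex_qform_affine m (S : 'M[R]_m) (a : 'cV[R]_m)
    (L : nat -> 'M[R]_(m, n)) k :
  Ex Pr (fun om => qform S (a + \sum_(j < k) L j *m w j om)) =
  qform S a + \sum_(j < k) Ex Pr (fun om => qform S (L j *m w 0%N om)).
Proof.
elim: k => [|k IH].
  by rewrite big_ord0 addr0; under eq_fun do rewrite big_ord0 addr0;
    exact: Ex_cst.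
rewrite big_ord_recr/= [in RHS]addrA -IH.
pose y om := a + \sum_(j < k) L j *m w j om.
have by' : bounded_rvec (y : past w k -> _).
  apply: bounded_rvecD; first exact: bounded_rvec_cst.
  apply: bounded_rvec_sum => j _; apply: bounded_rvec_mulmx.
  exact: bounded_rvec_noise_past.
have by0 : bounded_rvec y by move=> i; exact: (bounded_rv_of_past hw (by' i)).
have bw := bounded_rvec_noise k.
rewrite (_ : (fun om => qform S (a + _)) = fun om => qform S (y om) +
  (dot ((L k)^T *m ((S + S^T) *m y om)) (w k om) + qform S (L k *m w k om)));
    last first.
  by apply/funext => om; rewrite big_ord_recr/= addrA qformD -dot_mulmxr addrA.
have bL : bounded_rvec (fun om => L k *m w k om) by exact: bounded_rvec_mulmx.
have bd : bounded_rv (fun om => dot ((L k)^T *m ((S + S^T) *m y om)) (w k om)).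
  by apply: bounded_rv_dot => //; do 2 apply: bounded_rvec_mulmx.
have bqy : bounded_rv (fun om => qform S (y om)) by exact: bounded_rv_qform.
have bqL : bounded_rv (fun om => qform S (L k *m w k om)) by exact:
  bounded_rv_qform.
have bs := bounded_rvD bd bqL.
rewrite ExD// ExD// Ex_dot_noise ?add0r ?Ex_qform_noise//.
by do 2 apply: bounded_rvec_mulmx.
Qed.

End CentredNoise.

Section AlmostSure.
Variables (R : realType) (d : measure_display) (Omega : measurableType d).
Variable Pr : probability Omega R.

(** By monotone convergence the total sum has a finite integral. *)
Lemma ae_bounded_sums (f : nat -> Omega -> R) (C : R) :
  (forall k, bounded_rv (f k)) -> (forall k om, 0 <= f k om) ->
  (forall T, \sum_(k < T) Ex Pr (f k) <= C) ->
  {ae Pr, forall om, exists M, forall T, \sum_(k < T) f k om <= M}.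
Proof.
move=> bf f0 fC.
pose g om : \bar R := (\sum_(0 <= k <oo) (f k om)%:E)%E.
have mf k : measurable_fun setT (fun om => (f k om)%:E).
  by apply/measurable_EFinP; have [] := bf k.
have gC : (\int[Pr]_om g om <= C%:E)%E.
  rewrite integral_nneseries//; last by move=> k om _; rewrite lee_fin.
  apply: lime_le; first by apply: is_cvg_nneseries => k _ _;
    apply: integral_ge0 => om _; rewrite lee_fin.
  apply: nearW => T; rewrite big_mkord.
  under eq_bigr do rewrite integral_Ex//.
  by rewrite sumEFin lee_fin.
have g0 om : (0 <= g om)%E by apply: nneseries_ge0 => k _ _; rewrite lee_fin.
have mg : measurable_fun setT g.
  by apply: ge0_emeasurable_sum => // k om _ _; rewrite lee_fin.
have ig : Pr.-integrable setT g.
  apply/integrableP; split => //.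
  under eq_integral do rewrite gee0_abs//.
  exact: le_lt_trans gC (ltry _).
apply: filterS (integrable_ae measurableT ig) => om /(_ I) gfin.
exists (fine (g om)) => T; rewrite -lee_fin fineK// -sumEFin.
rewrite -(big_mkord xpredT (fun k => (f k om)%:E)).
by apply: nneseries_lim_ge => k _; rewrite lee_fin.
Qed.

Lemma bounded_sums_cvg0 (f : nat -> R) (M : R) :
  (forall k, 0 <= f k) -> (forall T, \sum_(k < T) f k <= M) -> f @ \oo --> 0.
Proof.
move=> f0 fM; apply: cvg_series_cvg_0.
apply: nondecreasing_is_cvgn.
  by apply/nondecreasing_seqP => k; rewrite /series/= big_nat_recr//= lerDl.
by exists M => _ [T _ <-]; rewrite /series/= big_mkord.
Qed.

Lemma sum_inv_sqr_le2 T : \sum_(k < T) (k.+1%:R ^- 2 : R) <= 2.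
Proof.
case: T => [|T]; first by rewrite big_ord0.
suff: \sum_(k < T.+1) (k.+1%:R ^- 2 : R) <= 2 - T.+1%:R^-1.
  by move=> /le_trans; apply; rewrite lerBlDr lerDl.
elim: T => [|T IH]; first by rewrite big_ord_recr big_ord0/= expr1n invr1; lra.
rewrite big_ord_recr/=; apply: le_trans (lerD IH (lexx _)) _.
rewrite -addrA lerD2l.
have T1 : 0 < (T.+1%:R : R) by [].
have -> : (T.+2%:R : R) = T.+1%:R + 1 by rewrite natr1.
set t : R := T.+1%:R in T1 *.
have t10 : 0 < t + 1 by rewrite ltr_wpDr.
rewrite -subr_ge0.
have -> : - (t + 1)^-1 - (- t^-1 + (t + 1) ^- 2) = t^-1 * (t + 1) ^- 2.
  by field; rewrite !gt_eqF.
by rewrite mulr_ge0// invr_ge0 ?exprn_ge0 ?ltW.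
Qed.

Lemma nat_between_squares k : (0 < k)%N ->
  exists n, (n.+1 ^ 2 <= k)%N /\ (k <= n.+1 ^ 2 + 2 * n.+1)%N.
Proof.
elim: k => // -[|k] IH _; first by exists 0%N.
have [n [nk kn]] := IH isT.
have [kn'|] := leqP k.+2 (n.+1 ^ 2 + 2 * n.+1); first by exists n; split; lia.
by move=> nk'; exists n.+1; split; lia.
Qed.

Lemma cvg_invn_mul (c : R) : (fun k => k%:R^-1 * c) @ \oo --> 0.
Proof.
rewrite -[0](mul0r c); apply: cvgMl.
rewrite -cvg_shiftS; exact: cvg_harmonic.
Qed.

(** Between [n^2] and [(n+1)^2] a sequence with bounded increments moves by
  [O(n)], which is negligible against [n^2]. *)
Lemma cvg_average_of_squares (m : nat -> R) (C : R) :
  (forall k, `|m k.+1 - m k| <= C) ->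
  (fun n => ((n.+1 ^ 2)%:R^-1 * m (n.+1 ^ 2)%N) ^+ 2) @ \oo --> 0 ->
  (fun k => k%:R^-1 * m k) @ \oo --> 0.
Proof.
move=> mC m2; have C0 : 0 <= C := le_trans (normr_ge0 _) (mC 0%N).
have mD k j : `|m (k + j)%N - m k| <= C * j%:R.
  elim: j => [|j IH]; first by rewrite addn0 subrr normr0 mulr0.
  rewrite addnS (le_trans (ler_distD (m (k + j)%N) _ _))//.
  by rewrite -natr1 mulrDr mulr1 addrC lerD.
apply/cvgr0Pnorm_le => e e0.
have e20 : 0 < (e / 2) ^+ 2 by rewrite exprn_gt0 ?divr_gt0.
have /cvgr0Pnorm_le/(_ _ e20)[n0 _ Hn0] := m2.
(* from n1 on, the oscillation C * 2 (n + 1) is at most (n + 1)^2 * e / 2 *)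
have [n1 n1C] : exists n1 : nat, 4 * C / e <= n1%:R.
  by exists (Num.bound (4 * C / e));
    rewrite ltW// archi_boundP// divr_ge0 ?mulr_ge0 ?(ltW e0).
exists ((n0 + n1).+1 ^ 2 + 2 * (n0 + n1).+1).+1%N => // k /= kn.
have k0 : (0 < k)%N by apply: leq_trans kn.
have [n [nk kn']] := nat_between_squares k0.
have n01 : (n0 + n1 <= n)%N by nia.
have := Hn0 n (leq_trans (leq_addr _ _) n01).
rewrite /= ger0_norm ?sqr_ge0// -real_normK ?num_real// ler_sqr ?nnegrE//;
  last first.
  by rewrite divr_ge0// ltW.
rewrite normrM normfV normr_nat ler_pdivrMl ?ltr0n ?expn_gt0// => mn.
have mk : `|m k| <= (n.+1 ^ 2)%:R * (e / 2) + C * (k - n.+1 ^ 2)%:R.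
  rewrite -{1}(subnKC nk) -[X in `|X|](subrK (m (n.+1 ^ 2)%N)).
  by rewrite (le_trans (ler_normD _ _))// addrC lerD.
rewrite normrM normfV normr_nat ler_pdivrMl ?ltr0n// (le_trans mk)//.
have nk2 : ((k - n.+1 ^ 2)%:R : R) <= 2 * n.+1%:R.
  by rewrite -natrM ler_nat; lia.
have nkR : ((n.+1 ^ 2)%:R : R) <= k%:R by rewrite ler_nat.
have n1R : (n1%:R : R) <= n.+1%:R by rewrite ler_nat; lia.
have Ce : 4 * C <= e * n.+1%:R.
  by rewrite -ler_pdivrMl// mulrC (le_trans n1C).
have Ck : C * (k - n.+1 ^ 2)%:R <= C * (2 * n.+1%:R) by exact: ler_wpM2l.
have Cn : C * (2 * n.+1%:R) <= (n.+1 ^ 2)%:R * (e / 2).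
  have := ler_wpM2r (ler0n R n.+1) Ce; rewrite natrX expr2; nra.
have ek : (n.+1 ^ 2)%:R * e <= k%:R * e by apply: ler_wpM2r => //; exact: ltW.
by lra.
Qed.

(** Orthogonality gives [E M_k^2 = O(k)], so the squares of the averages at
  times [n^2] have summable expectations and tend to 0; the bounded increments
  fill the gaps. *)
Lemma martingale_lln (M dM : nat -> Omega -> R) (C : R) :
  (forall om, M 0%N om = 0) -> (forall k om, M k.+1 om = M k om + dM k om) ->
  (forall k, bounded_rv (dM k)) -> (forall k om, `|dM k om| <= C) ->
  (forall k, Ex Pr (fun om => M k om * dM k om) = 0) ->
  {ae Pr, forall om, k%:R^-1 * M k om @[k --> \oo] --> 0}.
Proof.
move=> M0 MS bd dC orth.
have bM k : bounded_rv (M k).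
  elim: k => [|k IH].
    by rewrite (_ : M 0%N = fun=> 0); [exact: bounded_rv_cst|exact/funext].
  by rewrite (_ : M k.+1 = fun om => M k om + dM k om);
    [exact: bounded_rvD|exact/funext].
have bc c : bounded_rv (fun _ : Omega => c) := bounded_rv_cst _ c.
have M2 k : Ex Pr (fun om => M k om ^+ 2) <= C ^+ 2 * k%:R.
  elim: k => [|k IH].
    under eq_fun do rewrite M0 expr0n/=.
    by rewrite Ex_cst mulr0.
  have bMM : bounded_rv (fun om => M k om ^+ 2) by exact: bounded_rvM.
  have bMd : bounded_rv (fun om => M k om * dM k om) by exact: bounded_rvM.
  have b2Md : bounded_rv (fun om => 2 * (M k om * dM k om)) by exact:
    bounded_rvM.
  have bdd : bounded_rv (fun om => dM k om ^+ 2) by exact: bounded_rvM.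
  rewrite (_ : (fun om => M k.+1 om ^+ 2) =
      fun om => M k om ^+ 2 + (2 * (M k om * dM k om) + dM k om ^+ 2));
        last first.
    by apply/funext => om; rewrite MS; ring.
  rewrite ExD//; last exact: bounded_rvD.
  rewrite ExD// ExM// orth mulr0 add0r -natr1 mulrDr mulr1 lerD//.
  rewrite -(Ex_cst Pr (C ^+ 2)); apply: Ex_le => // om.
  rewrite -real_normK ?num_real// ler_sqr ?nnegrE//.
  exact: le_trans (dC k om).
pose f n om := ((n.+1 ^ 2)%:R^-1 * M (n.+1 ^ 2)%N om) ^+ 2.
have bf n : bounded_rv (f n).
  rewrite /f; under eq_fun do rewrite expr2.
  by apply: bounded_rvM; apply: bounded_rvM.
have fC T : \sum_(n < T) Ex Pr (f n) <= C ^+ 2 * 2.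
  apply: (@le_trans _ _ (C ^+ 2 * \sum_(n < T) n.+1%:R ^- 2)); last first.
    by apply: ler_wpM2l; rewrite ?sqr_ge0// sum_inv_sqr_le2.
  rewrite mulr_sumr; apply: ler_sum => n _; rewrite /f.
  under eq_fun do rewrite exprMn.
  rewrite ExM; last exact: bounded_rvM.
  have n0 : (n.+1%:R : R) != 0 by [].
  have K := ler_wpM2l (sqr_ge0 ((n.+1 ^ 2)%:R^-1 : R)) (M2 (n.+1 ^ 2)%N).
  apply: (le_trans K).
  by rewrite natrX le_eqVlt; apply/orP; left; apply/eqP; field.
apply: filterS (ae_bounded_sums bf (fun k om => sqr_ge0 _) fC) => om [B fB].
apply: (@cvg_average_of_squares _ C) => [k|].
  by rewrite MS addrC addKr.
by apply: (@bounded_sums_cvg0 (fun n => f n om) B) => // k; exact: sqr_ge0.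
Qed.

End AlmostSure.

(** * Affine disturbance feedback and the shifted policy *)

Section AffinePolicies.
Variables (R : realType) (nx nu nw : nat).
Variables (A : 'M[R]_nx) (B : 'M[R]_(nx, nu)) (D : 'M[R]_(nx, nw)).
Variable K : 'M[R]_(nu, nx).
Implicit Types (x : 'cV[R]_nx) (v : nat -> 'cV[R]_nu) (w : nat -> 'cV[R]_nw).
Implicit Types (M : nat -> nat -> 'M[R]_(nu, nw)) (dist : 'cV[R]_nw).

Local Notation ps := (pred_state A B D).

(** The coefficient of the disturbance [w j] in the predicted state [i]. *)
Fixpoint state_gain M i j : 'M[R]_(nx, nw) :=
  if i is i'.+1 then
    if (j < i')%N then A *m state_gain M i' j + B *m M i' j else D
  else 0.

Lemma pred_stateE x v M w i :
  ps x v M w i = ps x v M (fun=> 0) i + \sum_(j < i) state_gain M i j *m w j.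
Proof.
elim: i => [|i IH]; first by rewrite big_ord0 addr0.
rewrite big_ord_recr/= ltnn {1}IH /pred_input.
have -> : \sum_(j < i)
  (if (j < i)%N then A *m state_gain M i j + B *m M i j else D) *m w j
    = A *m (\sum_(j < i) state_gain M i j *m w j) + B *m
      (\sum_(j < i) M i j *m w j).
  rewrite !mulmx_sumr -big_split/=; apply: eq_bigr => j _.
  by rewrite ltn_ord mulmxDl !mulmxA.
have -> : \sum_(j < i) M i j *m (0 : 'cV[R]_nw) = 0 by apply: big1 => j _;
  exact: mulmx0.
rewrite !mulmxDr !mulmx0 !addr0.
by rewrite !addrA; congr (_ + _); rewrite -!addrA; congr (_ + _);
  rewrite addrCA.
Qed.

(** [corr_mean] and [corr_gain] are the coefficients of the deviation [u_i - K
  x_i], an affine function of the disturbances before time [i]. *)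
Definition corr_mean x v M i := v i - K *m ps x v M (fun=> 0) i.
Definition corr_gain M i j := M i j - K *m state_gain M i j.

Lemma correctionE x v M w i :
  pred_input v M w i - K *m ps x v M w i =
  corr_mean x v M i + \sum_(j < i) corr_gain M i j *m w j.
Proof.
rewrite pred_stateE /pred_input /corr_mean /corr_gain.
have -> : \sum_(j < i) (M i j - K *m state_gain M i j) *m w j =
    \sum_(j < i) M i j *m w j - K *m (\sum_(j < i) state_gain M i j *m w j).
  rewrite mulmx_sumr -sumrB; apply: eq_bigr => j _.
  by rewrite mulmxBl mulmxA.
by rewrite mulmxDr opprD addrACA.
Qed.

Definition cons_noise dist w i := if i is j.+1 then w j else dist.

(** The policy seen one step later, the first disturbance [dist] being known;
  its last input is the terminal feedback [K x_N]. *)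
Definition shift_input N x v M dist i :=
  if (i.+1 < N)%N then v i.+1 + M i.+1 0%N *m dist
  else K *m (ps x v M (fun=> 0) i.+1 + state_gain M i.+1 0%N *m dist).

Definition shift_gain N M i j :=
  if (i.+1 < N)%N then M i.+1 j.+1 else K *m state_gain M i.+1 j.+1.

Section Shift.
Variables (N : nat) (x : 'cV[R]_nx) (v : nat -> 'cV[R]_nu).
Variables (M : nat -> nat -> 'M[R]_(nu, nw)) (dist : 'cV[R]_nw).

Local Notation xs := (A *m x + B *m v 0%N + D *m dist).
Local Notation vs := (shift_input N x v M dist).
Local Notation Ms := (shift_gain N M).

Lemma pred_input_shift w i : (i.+1 < N)%N ->
  pred_input vs Ms w i = pred_input v M (cons_noise dist w) i.+1.
Proof.
move=> iN; rewrite /pred_input /shift_input /shift_gain iN big_ord_recl/=.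
by rewrite -addrA; congr (_ + (_ + _)).
Qed.

Lemma pred_state_shift w i : (i < N)%N ->
  ps xs vs Ms w i = ps x v M (cons_noise dist w) i.+1.
Proof.
elim: i => [|i IH] iN.
  by rewrite /= /pred_input big_ord0 addr0.
by rewrite /= IH ?(ltnW iN)// pred_input_shift.
Qed.

Lemma pred_input_shift_last w i : N = i.+1 ->
  pred_input vs Ms w i = K *m ps x v M (cons_noise dist w) i.+1.
Proof.
move=> NE; rewrite [in RHS]pred_stateE big_ord_recl.
rewrite /pred_input {1}/shift_input NE ltnn [in RHS]addrA [in RHS]mulmxDr.
congr (_ + _); rewrite mulmx_sumr; apply: eq_bigr => j _.
by rewrite /shift_gain ltnn mulmxA.
Qed.

Lemma state_gain_shift i j : (i < N)%N -> (j < i)%N ->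
  state_gain Ms i j = state_gain M i.+1 j.+1.
Proof.
elim: i => // i IH iN; rewrite /= !ltnS leq_eqVlt => ji.
case: (ltnP j i) => [ij|//]; rewrite IH ?(ltnW iN)//.
by rewrite /shift_gain iN.
Qed.

Lemma corr_mean_shift i : (i.+1 < N)%N ->
  corr_mean xs vs Ms i = corr_mean x v M i.+1 + corr_gain M i.+1 0%N *m dist.
Proof.
move=> iN; have := correctionE xs vs Ms (fun=> 0) i.
rewrite pred_input_shift// pred_state_shift ?(ltnW iN)//.
rewrite correctionE big_ord_recl/= big1 => [|j _]; last exact: mulmx0.
rewrite [X in _ = _ + X -> _]big1 => [|j _]; last exact: mulmx0.
by rewrite !addr0.
Qed.

Lemma corr_gain_shift i j : (i.+1 < N)%N -> (j < i)%N ->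
  corr_gain Ms i j = corr_gain M i.+1 j.+1.
Proof.
by move=> iN ji;
  rewrite /corr_gain state_gain_shift ?(ltnW iN)// /shift_gain iN.
Qed.

Lemma corr_mean_shift_last i : N = i.+1 -> corr_mean xs vs Ms i = 0.
Proof.
move=> NE; have := correctionE xs vs Ms (fun=> 0) i.
rewrite pred_input_shift_last// pred_state_shift ?NE// subrr.
by rewrite big1 ?addr0// => j _; exact: mulmx0.
Qed.

Lemma corr_gain_shift_last i j : N = i.+1 -> (j < i)%N -> corr_gain Ms i j = 0.
Proof.
move=> NE ji; rewrite /corr_gain state_gain_shift ?NE//.
by rewrite /shift_gain ltnn subrr.
Qed.

(** Apply feasibility of the given policy to [dist] followed by the new
  disturbances, and invariance of the terminal set for the additional step. *)
Lemma feasible_shift (W : set 'cV[R]_nw) (Z : set ('cV[R]_nx * 'cV[R]_nu))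
    (Xf : set 'cV[R]_nx) :
  (forall y, Xf y -> Z (y, K *m y) /\
     forall e, W e -> Xf ((A + B *m K) *m y + D *m e)) ->
  (0 < N)%N -> W dist -> feasible A B D W Z Xf N x v M ->
  feasible A B D W Z Xf N xs vs Ms.
Proof.
move=> hXf N0 Wd fea w wW.
have [|ZN XN] := fea (cons_noise dist w).
  by case=> //= i /ltnW/wW.
have NE : N = N.-1.+1 by rewrite prednK.
have sN : ps xs vs Ms w N.-1 = ps x v M (cons_noise dist w) N.
  by rewrite pred_state_shift -?NE.
split=> [i iN|].
  have [iN'|] := ltnP i.+1 N.
    by rewrite pred_state_shift// pred_input_shift//; exact: ZN.
  move=> Ni; have -> : i = N.-1 by lia.
  by rewrite sN pred_input_shift_last// -NE; have [] := hXf _ XN.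
have psS y v' M' i : (0 < i)%N -> ps y v' M' w i =
    A *m ps y v' M' w i.-1 + B *m pred_input v' M' w i.-1 + D *m w i.-1.
  by case: i.
rewrite psS// sN pred_input_shift_last// -NE mulmxA -mulmxDl.
by have [_] := hXf _ XN; apply; apply: wW; rewrite prednK.
Qed.

End Shift.

Lemma bounded_rvec_pred (d : measure_display) (T : measurableType d) x v M i
    (w : nat -> T -> 'cV[R]_nw) : (forall j, (j < i)%N -> bounded_rvec (w j)) ->
  bounded_rvec (fun om => ps x v M (w^~ om) i) /\
  bounded_rvec (fun om => pred_input v M (w^~ om) i).
Proof.
move=> bw; split.
  under eq_fun do rewrite pred_stateE.
  apply: bounded_rvecD; first exact: bounded_rvec_cst.
  by apply: bounded_rvec_sum => j _; apply: bounded_rvec_mulmx; exact: bw.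
apply: bounded_rvecD; first exact: bounded_rvec_cst.
by apply: bounded_rvec_sum => j _; apply: bounded_rvec_mulmx; exact: bw.
Qed.

End AffinePolicies.

(** * The cost of a policy *)

Section OptimalCost.
Variables (R : realType) (nx nu nw : nat).
Variables (A : 'M[R]_nx) (B : 'M[R]_(nx, nu)) (D : 'M[R]_(nx, nw)).
Variables (d : measure_display) (Omega : measurableType d)
  (Pr : probability Omega R).
Variables (w : nat -> Omega -> 'cV[R]_nw) (Cw : R).
Hypothesis hw : iid Pr w.
Hypothesis wC : forall j om, `|w j om| <= Cw.
Hypothesis hmean : forall k i, ('E_Pr[fun om => w k om i ord0] = 0)%E.
Variables (Q P : 'M[R]_nx) (Rw : 'M[R]_nu) (K : 'M[R]_(nu, nx)).
Hypothesis hR : pd Rw.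
Hypothesis hP : pd P.
Hypothesis hRiccati :
  P = Q + A^T *m P *m A - K^T *m (Rw + B^T *m P *m B) *m K.
Hypothesis hK : K = - (invmx (Rw + B^T *m P *m B) *m B^T *m P *m A).

Local Notation S := (Rw + B^T *m P *m B).

Definition second_moment (L : 'M[R]_(nu, nw)) :=
  Ex Pr (fun om => qform S (L *m w 0%N om)).

Definition noise_cost := Ex Pr (fun om => qform P (D *m w 0%N om)).

(** The expected sum of [(u_i - K x_i)^T S (u_i - K x_i)], in closed form. Being
  a quadratic polynomial in the policy, it makes sense before any disturbance is
  drawn and its dependence on an observed disturbance is explicit. *)
Definition excess N x v M :=
  \sum_(i < N) (qform S (corr_mean A B D K x v M i) +
    \sum_(j < i) second_moment (corr_gain A B D K M i j)).

Lemma qform_step x u e :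
  qform P (A *m x + B *m u + D *m e) + (qform Q x + qform Rw u) =
  qform P x + (qform S (u - K *m x) +
    (dot (D^T *m ((P + P^T) *m (A *m x + B *m u))) e + qform P (D *m e))).
Proof.
have := riccati_completion hR hP hRiccati hK x u.
rewrite (qformD P (A *m x + B *m u)) dot_mulmxr; lra.
Qed.

(** Sum the completed squares over the horizon; the terms linear in the
  disturbance have mean zero. *)
Lemma cost_excess N x v M :
  cost A B D Pr Q Rw P w N x v M =
  (qform P x + excess N x v M + noise_cost *+ N)%:E.
Proof.
have bps i : bounded_rvec (fun om => pred_state A B D x v M (w^~ om) i).
  by have [] := bounded_rvec_pred A B D x v M
    (fun j (_ : (j < i)%N) => bounded_rvec_noise hw wC j).
have bpi i : bounded_rvec (fun om => pred_input v M (w^~ om) i).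
  by have [] := bounded_rvec_pred A B D x v M
    (fun j (_ : (j < i)%N) => bounded_rvec_noise hw wC j).
have bstage i :
  bounded_rv (fun om => qform Q (pred_state A B D x v M (w^~ om) i) +
                  qform Rw (pred_input v M (w^~ om) i)).
  by apply: bounded_rvD; exact: bounded_rv_qform.
have bcost n : bounded_rv
  (fun om => qform P (pred_state A B D x v M (w^~ om) n) +
    \sum_(i < n) (qform Q (pred_state A B D x v M (w^~ om) i) +
                  qform Rw (pred_input v M (w^~ om) i))).
  by apply: bounded_rvD; [exact: bounded_rv_qform|exact: bounded_rv_sum].
rewrite /cost expectation_Ex//; congr EFin; elim: N => [|n IH].
  rewrite /excess big_ord0 mulr0n !addr0.
  by under eq_fun do rewrite big_ord0 addr0 /=; rewrite Ex_cst.
have bps' : bounded_rvec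
  ((fun om => pred_state A B D x v M (w^~ om) n) : past w n -> _).
  by have [] := @bounded_rvec_pred _ _ _ _ A B D _ (past w n) x v M n w
    (fun j jn => bounded_rvec_noise_past wC jn).
have bpi' : bounded_rvec
  ((fun om => pred_input v M (w^~ om) n) : past w n -> _).
  by have [] := @bounded_rvec_pred _ _ _ _ A B D _ (past w n) x v M n w
    (fun j jn => bounded_rvec_noise_past wC jn).
pose s om := A *m pred_state A B D x v M (w^~ om) n + B *m pred_input v M
  (w^~ om) n.
have bs : bounded_rvec s by apply: bounded_rvecD; exact: bounded_rvec_mulmx.
have bs' : bounded_rvec (s : past w n -> _).
  by apply: bounded_rvecD; exact: bounded_rvec_mulmx.
pose a := corr_mean A B D K x v M n; pose L := corr_gain A B D K M n.
rewrite (_ : (fun om => _) = fun om =>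
    (qform P (pred_state A B D x v M (w^~ om) n) +
     \sum_(i < n) (qform Q (pred_state A B D x v M (w^~ om) i) +
                   qform Rw (pred_input v M (w^~ om) i))) +
    (qform S (a + \sum_(j < n) L j *m w j om) +
     (dot (D^T *m ((P + P^T) *m s om)) (w n om) + qform P (D *m w n om))));
       last first.
  apply/funext => om; rewrite big_ord_recr/= addrA addrAC -addrA -/(s om).
  have := qform_step (pred_state A B D x v M (w^~ om) n)
    (pred_input v M (w^~ om) n) (w n om).
  rewrite (correctionE A B D K x v M (w^~ om) n) -/(s om) -/a -/L; lra.
have bc : bounded_rv (fun om => qform S (a + \sum_(j < n) L j *m w j om)).
  apply: bounded_rv_qform; apply: bounded_rvecD; first exact: bounded_rvec_cst.
  by apply: bounded_rvec_sum => j _; apply: bounded_rvec_mulmx;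
    exact: (bounded_rvec_noise hw wC).
have bd : bounded_rv (fun om => dot (D^T *m ((P + P^T) *m s om)) (w n om)).
  apply: bounded_rv_dot; last exact: (bounded_rvec_noise hw wC).
  by do 2 apply: bounded_rvec_mulmx.
have bDw : bounded_rv (fun om => qform P (D *m w n om)).
  by apply: bounded_rv_qform; apply: bounded_rvec_mulmx;
    exact: (bounded_rvec_noise hw wC).
have bdDw := bounded_rvD bd bDw.
rewrite (ExD _ (bcost n) (bounded_rvD bc bdDw)) (ExD _ bc bdDw) (ExD _ bd bDw).
rewrite IH (Ex_dot_noise hw wC hmean); last by do 2 apply: bounded_rvec_mulmx.
rewrite (Ex_qform_affine hw wC hmean) (Ex_qform_noise hw wC).
rewrite /excess big_ord_recr/= mulrSr /a /L -/noise_cost /second_moment; ring.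
Qed.

Lemma second_moment_ge0 L : 0 <= second_moment L.
Proof.
apply: Ex_ge0 => [|om]; last exact: pd_ge0 (riccati_weight_pd B hR hP).
by apply: bounded_rv_qform; apply: bounded_rvec_mulmx;
  exact: (bounded_rvec_noise hw wC).
Qed.

Lemma excess_ge0 N x v M : 0 <= excess N x v M.
Proof.
apply: sumr_ge0 => i _; apply: addr_ge0;
  first exact: pd_ge0 (riccati_weight_pd B hR hP).
by apply: sumr_ge0 => j _; exact: second_moment_ge0.
Qed.

Lemma excess_shift N x v M dist : (0 < N)%N ->
  excess N (A *m x + B *m v 0%N + D *m dist)
    (shift_input A B D K N x v M dist) (shift_gain A B D K N M) =
  \sum_(i < N.-1) (qform S (corr_mean A B D K x v M i.+1 +
                            corr_gain A B D K M i.+1 0%N *m dist) +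
    \sum_(j < i) second_moment (corr_gain A B D K M i.+1 j.+1)).
Proof.
case: N => // n _; rewrite /excess big_ord_recr/=.
rewrite corr_mean_shift_last// qform0 add0r [X in _ + X]big1 ?addr0 => [|j _].
  apply: eq_bigr => i _; rewrite corr_mean_shift ?ltnS//; congr (_ + _).
  by apply: eq_bigr => j _; rewrite corr_gain_shift// ltnS.
rewrite corr_gain_shift_last// /second_moment.
by under eq_fun do rewrite mul0mx qform0; exact: Ex_cst.
Qed.

Lemma bounded_rv_excess_shift N x v M : (0 < N)%N ->
  bounded_rv (fun om => excess N (A *m x + B *m v 0%N + D *m w 0%N om)
    (shift_input A B D K N x v M (w 0%N om)) (shift_gain A B D K N M)).
Proof.
move=> N0; under eq_fun do rewrite excess_shift//.
apply: bounded_rv_sum => i _; apply: bounded_rvD; last exact: bounded_rv_cst.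
apply: bounded_rv_qform; apply: bounded_rvecD; first exact: bounded_rvec_cst.
by apply: bounded_rvec_mulmx; exact: (bounded_rvec_noise hw wC).
Qed.

(** The deviations of the shifted policy are those of the old one, read one step
  later, except that the last one vanishes; averaging over the first disturbance
  restores its second moments, so only the term of time 0 is lost. *)
Lemma Ex_excess_shift N x v M : (0 < N)%N ->
  Ex Pr (fun om => excess N (A *m x + B *m v 0%N + D *m w 0%N om)
    (shift_input A B D K N x v M (w 0%N om)) (shift_gain A B D K N M)) +
  qform S (v 0%N - K *m x) = excess N x v M.
Proof.
move=> N0; under eq_fun do rewrite excess_shift//.
have bq a L : bounded_rv (fun om => qform S (a + L *m w 0%N om)).
  apply: bounded_rv_qform; apply: bounded_rvecD; first exact: bounded_rvec_cst.
  by apply: bounded_rvec_mulmx; exact: (bounded_rvec_noise hw wC).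
rewrite Ex_sum => [|i _]; last by apply: bounded_rvD => //;
  exact: bounded_rv_cst.
rewrite -[in RHS](prednK N0) /excess big_ord_recl/= addrC big_ord0 addr0.
congr (_ + _); apply: eq_bigr => i _.
rewrite ExD ?Ex_cst//; last exact: bounded_rv_cst.
rewrite big_ord_recl/= addrA; congr (_ + _).
have := Ex_qform_affine hw wC hmean S (corr_mean A B D K x v M i.+1)
  (fun=> corr_gain A B D K M i.+1 0%N) 1.
rewrite big_ord_recl big_ord0 addr0 => <-; congr (Ex _ _); apply/funext => om.
by rewrite big_ord_recl big_ord0 addr0.
Qed.

End OptimalCost.

(** * Recurrence of quiet blocks *)

Section Recurrence.
Variables (R : realType) (d : measure_display) (Omega : measurableType d).
Variables (Pr : probability Omega R) (n : nat) (w : nat -> Omega -> 'cV[R]_n).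
Hypothesis hw : iid Pr w.
Variable E : set (borel R n).
Hypothesis mE : measurable E.
Hypothesis E_gt0 : (0 < Pr (w 0%N @^-1` E))%E.

Let p := fine (Pr (w 0%N @^-1` E)).

Let PE k : Pr (w k @^-1` E) = p%:E.
Proof.
have [_ _ ident] := hw.
rewrite ident// fineK// fin_num_measure//.
by rewrite -[X in measurable X]setTI; apply: (measurable_noise hw).
Qed.

Definition noise_block k m :=
  \bigcap_(j in [set j | (j < m)%N]) w (k + j)%N @^-1` E.

Lemma noise_block_past k m :
  measurable (noise_block k m : set (past w (k + m))).
Proof.
apply: fin_bigcap_measurable => [|j /= jm]; first exact: finite_II.
rewrite -[X in measurable X]setTI;
  apply: (noise_past_measurable (k := (k + m))) => //.
by rewrite ltn_add2l.
Qed.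

(** Induction on [m], moving the first disturbance of the block into the past.
  *)
Lemma past_noise_block k m (A : set Omega) : measurable (A : set (past w k)) ->
  Pr (A `&` noise_block k m) = (Pr A * (p ^+ m)%:E)%E.
Proof.
elim: m k A => [|m IH] k A mA.
  have -> : noise_block k 0 = setT by rewrite /noise_block; apply/seteqP; split.
  by rewrite setIT expr0 mule1.
have -> : A `&` noise_block k m.+1 = (A `&` w k @^-1` E) `&` noise_block k.+1 m.
  apply/seteqP; split=> om.
    move=> [Aom wE]; split; first by split => //; have := wE 0%N isT;
      rewrite /= addn0.
    by move=> j /= jm; have := wE j.+1 jm; rewrite addnS.
  move=> [[Aom wkE] wE]; split => // -[|j] /= jm; first by rewrite addn0.
  by rewrite addnS; exact: wE.
rewrite IH; last first.
  apply: (@measurableI _ (past w k.+1)).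
    exact: (measurable_past_le (leqnSn k)).
  rewrite -[X in measurable X]setTI; exact: (noise_past_measurable (k := k.+1)).
by rewrite (past_noise_indep hw)// PE -muleA -EFinM exprS.
Qed.

(** The earlier blocks belong to the past of the next one, so each further
  failure multiplies the probability by the same factor. *)
Lemma no_small_block k m L :
  let H := \bigcap_(i in [set i | (i < L)%N]) ~` noise_block (k + i * m)%N m in
  measurable (H : set (past w (k + L * m))) /\ Pr H = ((1 - p ^+ m) ^+ L)%:E.
Proof.
elim: L => [|L [mH PH]] /=.
  have -> : \bigcap_(i in [set i | (i < 0)%N]) ~` noise_block (k + i * m)%N m =
    setT.
    by apply/seteqP; split.
  by split; [exact: (@measurableT _ (past w _))|rewrite probability_setT expr0].
set H := \bigcap_(i in _) _ in mH PH.
have -> : \bigcap_(i in [set i | (i < L.+1)%N]) ~` noise_block (k + i * m)%N m =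
    H `&` ~` noise_block (k + L * m)%N m.
  apply/seteqP; split=> om.
    by move=> Hom; split=> [i /= iL|]; apply: Hom => //=; rewrite ltnS ltnW.
  by move=> [Hom HL] i /=; rewrite ltnS leq_eqVlt => /orP[/eqP ->//|/Hom].
have mb : measurable
  (noise_block (k + L * m)%N m : set (past w (k + L.+1 * m))).
  have -> : (k + L.+1 * m = k + L * m + m)%N by rewrite mulSn; lia.
  exact: noise_block_past.
split.
  apply: (@measurableI _ (past w (k + L.+1 * m))).
    by apply: (measurable_past_le _ mH); rewrite mulSn; lia.
  exact: (@measurableC _ (past w (k + L.+1 * m))).
rewrite -setDE measureD//.
  transitivity (Pr H - Pr H * (p ^+ m)%:E)%E.
    by congr (_ - _)%E; exact: past_noise_block.
  rewrite PH -EFinM -EFinB exprSr mulrBr mulr1.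
  by [].
exact: (past_measurable hw mH).
exact: (past_measurable hw mb).
exact: (le_lt_trans (probability_le1 Pr (past_measurable hw mH)) (ltry _)).
Qed.

(** Consecutive blocks after any time [T] are independent, so almost surely one
  of them stays in [E]. *)
Lemma ae_small_blocks m :
  {ae Pr, forall om, forall T, exists2 t, (T <= t)%N &
    forall j, (j < m)%N -> E (w (t + j)%N om)}.
Proof.
apply: ae_foralln => T.
pose H L := \bigcap_(i in [set i | (i < L)%N]) ~` noise_block (T + i * m)%N m.
have mH L : measurable (H L) by have [/(past_measurable hw)]
  := no_small_block T m L.
have PH L : Pr (H L) = ((1 - p ^+ m) ^+ L)%:E by have []
  := no_small_block T m L.
have p0 : 0 < p by rewrite -lte_fin -(PE 0).
have p1 : p <= 1
  by rewrite -lee_fin -(PE 0) probability_le1// -[X in measurable X]setTI;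
  apply: (measurable_noise hw).
exists (\bigcap_L H L); split.
- exact: bigcapT_measurable.
- apply/eqP; rewrite eq_le measure_ge0 andbT; apply/lee_addgt0Pr => e e0.
  have pm0 : 0 < p ^+ m by exact: exprn_gt0.
  have pm1 : p ^+ m <= 1 by apply: exprn_ile1 => //; exact: ltW.
  have /cvgr0Pnorm_le/(_ e e0)[L _ HL] : (fun L => (1 - p ^+ m) ^+ L) @ \oo -->
    (0 : R).
    by apply: cvg_expr; rewrite ger0_norm ?subr_ge0// ltrBlDr ltrDl.
  rewrite add0e; apply: (@le_trans _ _ (Pr (H L))).
    by apply: le_measure; rewrite ?inE//;
      [exact: bigcapT_measurable|exact: bigcap_inf].
  by rewrite PH lee_fin (le_trans (ler_norm _))// HL /=.
- move=> om /= nb L _ i /= iL b; apply: nb.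
  by exists (T + i * m)%N; [exact: leq_addr|move=> j jm; exact: b].
Qed.

End Recurrence.

(** * The closed loop *)

Section ClosedLoop.
Variables (R : realType) (nx nu nw : nat).
Variables (A : 'M[R]_nx) (B : 'M[R]_(nx, nu)) (D : 'M[R]_(nx, nw)).
Variables (d : measure_display) (Omega : measurableType d)
  (Pr : probability Omega R).
Variables (w : nat -> Omega -> 'cV[R]_nw) (W : set 'cV[R]_nw) (Cw : R).
Variables (Z : set ('cV[R]_nx * 'cV[R]_nu)) (Cz : R).
Hypothesis hwW : forall k om, W (w k om).
Hypothesis hW0 : W 0.
Hypothesis WC : forall e, W e -> `|e| <= Cw.
Hypothesis hw : iid Pr w.
Hypothesis hmean : forall k i, ('E_Pr[fun om => w k om i ord0] = 0)%E.
Hypothesis ZC : forall x u, Z (x, u) -> `|x| <= Cz /\ `|u| <= Cz.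
Variables (Q P : 'M[R]_nx) (Rw : 'M[R]_nu) (K : 'M[R]_(nu, nx)).
Hypothesis hR : pd Rw.
Hypothesis hP : pd P.
Hypothesis hRiccati :
  P = Q + A^T *m P *m A - K^T *m (Rw + B^T *m P *m B) *m K.
Hypothesis hK : K = - (invmx (Rw + B^T *m P *m B) *m B^T *m P *m A).
Variables (Xf : set 'cV[R]_nx) (N : nat) (kappa : 'cV[R]_nx -> 'cV[R]_nu).
Hypothesis hXf : forall x, Xf x -> Z (x, K *m x) /\
     forall dist, W dist -> Xf ((A + B *m K) *m x + D *m dist).
Hypothesis hN : (0 < N)%N.
Hypothesis hkappa : receding_horizon_law A B D Pr Q Rw P w W Z Xf N kappa.
Hypothesis hkappa_meas : measurable_fun setT (kappa : borel R nx -> borel R nu).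

Local Notation S := (Rw + B^T *m P *m B).
Local Notation feas := (feasible_set A B D W Z Xf N).
Local Notation excess := (excess A B D Pr w P Rw K N).

Let wC j om : `|w j om| <= Cw. Proof. exact: WC (hwW j om). Qed.

Let costE := @cost_excess _ _ _ _ A B D _ _ Pr w Cw hw wC hmean Q P Rw K hR hP
  hRiccati hK.

Definition correction x := kappa x - K *m x.
Definition step x e := A *m x + B *m kappa x + D *m e.

Lemma stepE x e : step x e = (A + B *m K) *m x + B *m correction x + D *m e.
Proof.
rewrite /step /correction mulmxDl mulmxBr mulmxA.
by congr (_ + _); rewrite -addrA; congr (_ + _); rewrite addrC subrK.
Qed.

(** By [cost_excess] the cost and the excess differ by a constant that depends
  on the state only. *)
Lemma law_excess_min x : feas x -> exists v M,
  [/\ feasible A B D W Z Xf N x v M, kappa x = v 0%N &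
      forall v' M', feasible A B D W Z Xf N x v' M' ->
        excess x v M <= excess x v' M'].
Proof.
move=> /hkappa[v [M [[fea opt] kE]]]; exists v, M; split => // v' M' /opt.
rewrite !costE lee_fin.
by rewrite lerD2r lerD2l.
Qed.

Lemma feasible_step x e : feas x -> W e -> feas (step x e).
Proof.
move=> /law_excess_min[v [M [fea kE _]]] We.
rewrite /step kE.
exists (shift_input A B D K N x v M e), (shift_gain A B D K N M).
exact: feasible_shift.
Qed.

Lemma feasible_admissible x : feas x -> Z (x, kappa x).
Proof.
move=> /law_excess_min[v [M [fea -> _]]].
have [//|/(_ 0%N hN) /=] := fea (fun=> 0).
by rewrite /pred_input big_ord0 addr0.
Qed.

Section Terminal.

Let Phi := A + B *m K.

Let vK (x : 'cV[R]_nx) i := K *m (Phi ^+ i *m x).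
Let MK i j : 'M[R]_(nu, nw) := K *m (Phi ^+ (i.-1 - j) *m D).

Let pred_K x (e : nat -> 'cV[R]_nw) i :
  pred_state A B D x (vK x) MK e i = lin_traj Phi D x e i /\
  pred_input (vK x) MK e i = K *m lin_traj Phi D x e i.
Proof.
have iE j : pred_input (vK x) MK e j = K *m lin_traj Phi D x e j.
  rewrite lin_trajE mulmxDr /pred_input; congr (_ + _).
  rewrite (reindex_inj rev_ord_inj)/= mulmx_sumr; apply: eq_bigr => l _.
  rewrite /MK; case: j l => [[]//|j] l /=.
  by rewrite subSS subKn ?mulmxA// -ltnS.
split => //; elim: i => [//|i IH].
by rewrite /= iE IH mulmxDl mulmxA.
Qed.

Let terminal_traj x e i : Xf x -> (forall j, (j < i)%N -> W (e j)) ->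
  Xf (lin_traj Phi D x e i).
Proof.
move=> Xx; elim: i => [//|i IH] We /=.
by have [_] := hXf (IH (fun j ji => We j (ltnW ji))); apply; exact: We.
Qed.

Let terminal_policy_feasible x : Xf x -> feasible A B D W Z Xf N x (vK x) MK.
Proof.
move=> Xx e We; split=> [i iN|].
  have [-> ->] := pred_K x e i.
  have Xi : Xf (lin_traj Phi D x e i).
    by apply: terminal_traj => // j ji; apply: We; exact: ltn_trans iN.
  by have [] := hXf Xi.
by have [-> _] := pred_K x e N; exact: terminal_traj.
Qed.

Lemma terminal_feasible x : Xf x -> feas x.
Proof. by move=> /terminal_policy_feasible ?; exists (vK x), MK. Qed.

Let terminal_policy_excess x : excess x (vK x) MK = 0.
Proof.
have cm i : corr_mean A B D K x (vK x) MK i = 0.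
  have := correctionE A B D K x (vK x) MK (fun=> 0) i.
  rewrite big1 => [|j _]; last exact: mulmx0.
  have [-> ->] := pred_K x (fun=> 0) i.
  by rewrite subrr addr0.
(* the gain vanishes because the deviation does for a single disturbance *)
have cg i j (e : 'cV[R]_nw) : (j < i)%N -> corr_gain A B D K MK i j *m e = 0.
  move=> ji; pose f l := if l == j then e else 0.
  have := correctionE A B D K x (vK x) MK f i.
  have [-> ->] := pred_K x f i.
  rewrite subrr cm add0r (bigD1 (Ordinal ji))//= big1 ?addr0 => [cgE|l lj].
    by move: cgE; rewrite /f eqxx => <-.
  by rewrite /f -[j]/(nat_of_ord (Ordinal ji)) (inj_eq val_inj) (negPf lj)
    mulmx0.
apply: big1 => i _; rewrite cm qform0 add0r big1// => j _.
rewrite /second_moment; under eq_fun do rewrite cg// qform0.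
exact: Ex_cst.
Qed.

(** The feedback [u = K x] is a feasible policy on the terminal set, of zero
  excess. An optimal policy has zero excess too, and the square of its first
  correction is part of it. *)
Lemma terminal_correction0 x : Xf x -> correction x = 0.
Proof.
move=> Xx; have [v [M [fea kE opt]]] := law_excess_min (terminal_feasible Xx).
have le0 := opt _ _ (terminal_policy_feasible Xx);
  rewrite terminal_policy_excess in le0.
have shiftE := Ex_excess_shift A B D hw wC hmean P Rw K x v M hN.
apply/eqP; apply: contraT => c0.
have := (riccati_weight_pd B hR hP).2 _ c0; rewrite /correction kE.
have bsh := bounded_rv_excess_shift A B D hw wC P Rw K x v M hN.
have := Ex_ge0 Pr bsh (fun om => excess_ge0 A B D hw wC K hR hP _ _ _ _).
lra.
Qed.

End Terminal.

Definition excess_stage x := qform S (correction x).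

Lemma excess_stage_ge0 x : 0 <= excess_stage x.
Proof. exact: pd_ge0 (riccati_weight_pd B hR hP). Qed.

(** The recursion is on the initial state, by conditioning on the first
  disturbance, so that it can be compared with the excess of a shifted policy
  state by state. *)
Fixpoint excess_to_go T x : \bar R :=
  if T is T'.+1 then
    ((excess_stage x)%:E + \int[Pr]_om excess_to_go T' (step x (w 0%N om)))%E
  else 0%E.

Lemma excess_to_go_ge0 T x : (0 <= excess_to_go T x)%E.
Proof.
case: T => [//|T] /=; apply: adde_ge0;
  first by rewrite lee_fin excess_stage_ge0.
elim: T x => [|T IH] x /=; first by rewrite integral0.
apply: integral_ge0 => om _; apply: adde_ge0;
  first by rewrite lee_fin excess_stage_ge0.
exact: IH.
Qed.

Lemma measurable_excess_stage :
  measurable_fun setT (excess_stage : borel R nx -> R).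
Proof.
apply: measurable_qform; apply: measurable_vecD => //.
have mid : measurable_fun setT (id : borel R nx -> borel R nx) by [].
rewrite (_ : (fun t => - (K *m t)) = fun t => (- K) *m t).
  exact: measurable_vec_mulmx.
by apply/funext => t; rewrite mulNmx.
Qed.

Lemma measurable_step (d' : measure_display) (T : measurableType d')
    (X : T -> 'cV[R]_nx) (e : T -> 'cV[R]_nw) :
  measurable_fun setT (X : T -> borel R nx) ->
    measurable_fun setT (e : T -> borel R nw) ->
  measurable_fun setT ((fun t => step (X t) (e t)) : T -> borel R nx).
Proof.
move=> mX me; apply: measurable_vecD; last exact: measurable_vec_mulmx.
apply: measurable_vecD; first exact: measurable_vec_mulmx.
by apply: measurable_vec_mulmx; exact: measurableT_comp hkappa_meas mX.
Qed.

Lemma measurable_excess_to_go T :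
  measurable_fun setT (excess_to_go T : borel R nx -> \bar R).
Proof.
elim: T => [|T IH] /=; first exact: measurable_cst.
apply: emeasurable_funD; first by apply/measurable_EFinP;
  exact: measurable_excess_stage.
pose f (p : borel R nx * Omega) := excess_to_go T (step p.1 (w 0%N p.2)).
apply: (measurable_fun_fubini_tonelli_F f) => [|p];
  last exact: excess_to_go_ge0.
apply: measurableT_comp IH _; apply: measurable_step;
  first exact: measurable_fst.
by apply: (measurableT_comp (measurable_noise hw 0)); exact: measurable_snd.
Qed.

(** The induction compares with the excess of an arbitrary feasible policy, and
  then uses the optimal policy at [x]: the next states are only compared with
  its shifts, which depend polynomially on the disturbance. *)
Lemma excess_to_go_le T x v M : feasible A B D W Z Xf N x v M ->
  (excess_to_go T x <= (excess x v M)%:E)%E.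
Proof.
elim: T x v M => [|T IH] x v M fea /=; first by rewrite lee_fin;
  exact: (excess_ge0 A B D hw wC).
have [|v' [M' [fea' kE opt]]] := @law_excess_min x; first by exists v, M.
apply: le_trans (_ : (excess x v' M')%:E <= _)%E; last by rewrite lee_fin;
  exact: opt.
rewrite -(Ex_excess_shift A B D hw wC hmean P Rw K x v' M' hN) (addrC (Ex _ _))
  EFinD.
rewrite /excess_stage /correction {1}kE; apply: leeD => //.
have bsh := bounded_rv_excess_shift A B D hw wC P Rw K x v' M' hN.
rewrite -(integral_Ex _ bsh); apply: ge0_le_integral => //.
- by move=> om _; exact: excess_to_go_ge0.
- apply: (measurableT_comp (measurable_excess_to_go T)).
  by apply: measurable_step;
    [exact: measurable_cst|exact: measurable_noise hw 0].
- by apply/measurable_EFinP; exact: bsh.1.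
- by move=> om _; rewrite /step kE; apply: IH; exact: feasible_shift.
Qed.

Variable x0 : 'cV[R]_nx.
Hypothesis hx0 : feas x0.

Local Notation x k om := (closed_loop A B D kappa x0 (w^~ om) k).

Lemma closed_loopS k om : x k.+1 om = step (x k om) (w k om).
Proof. by []. Qed.

Lemma closed_loop_feasible k om : feas (x k om).
Proof. by elim: k => // k IH; exact: feasible_step. Qed.

Lemma closed_loop_bounded k om : `|x k om| <= Cz /\ `|kappa (x k om)| <= Cz.
Proof. exact: ZC (feasible_admissible (closed_loop_feasible k om)). Qed.

Lemma closed_loop_measurable k :
  measurable_fun setT ((fun om => x k om) : past w k -> borel R nx).
Proof.
elim: k => [|k IH]; first exact: measurable_cst.
apply: measurable_step; last exact: noise_past_measurable.
by move=> _ E mE; rewrite setTI; apply: (measurable_past_le (leqnSn k));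
  rewrite -[X in measurable X]setTI; exact: IH.
Qed.

Lemma bounded_rvec_closed_loop k :
  bounded_rvec ((fun om => x k om) : past w k -> 'cV[R]_nx) /\
  bounded_rvec ((fun om => kappa (x k om)) : past w k -> 'cV[R]_nu).
Proof.
have mx := @closed_loop_measurable k.
have mu := measurableT_comp hkappa_meas mx.
have bx om := (closed_loop_bounded k om).1.
have bu om := (closed_loop_bounded k om).2.
split; first exact:
  (@bounded_rvecI R _ (past w k) nx (fun om => x k om) Cz mx bx).
exact: (@bounded_rvecI R _ (past w k) nu (fun om => kappa (x k om)) Cz mu bu).
Qed.

Lemma bounded_rv_excess_stage k : bounded_rv (fun om => excess_stage (x k om)).
Proof.
have [bx bu] := bounded_rvec_closed_loop k.
apply: bounded_rv_qform; apply: bounded_rvecD.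
  by move=> i; exact: (bounded_rv_of_past hw (bu i)).
apply: bounded_rvecN; apply: bounded_rvec_mulmx.
by move=> i; exact: (bounded_rv_of_past hw (bx i)).
Qed.

(** The Markov property: the disturbance [w k] can be replaced by a fresh copy
  because the state at time [k] depends on the past only. *)
Lemma sum_Ex_excess_stage T k :
  (\sum_(i < T) (Ex Pr (fun om => excess_stage (x (k + i)%N om)))%:E =
   \int[Pr]_om excess_to_go T (x k om))%E.
Proof.
elim: T k => [|T IH] k; first by rewrite big_ord0 integral0.
have mxk : measurable_fun setT ((fun om => x k om) : Omega -> borel R nx).
  exact: (past_measurable_fun hw (@closed_loop_measurable k)).
rewrite big_ord_recl /= addn0 ge0_integralD//; last 4 first.
- by move=> om _; rewrite lee_fin excess_stage_ge0.
- by apply/measurable_EFinP; exact: (bounded_rv_excess_stage k).1.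
- by move=> om _; apply: integral_ge0 => om' _; exact: excess_to_go_ge0.
- pose f (p : borel R nx * Omega) := excess_to_go T (step p.1 (w 0%N p.2)).
  have mf : measurable_fun setT f.
    apply: (measurableT_comp (measurable_excess_to_go T));
      apply: measurable_step; first exact: measurable_fst.
    by apply: (measurableT_comp (measurable_noise hw 0)); exact: measurable_snd.
  have := measurable_fun_fubini_tonelli_F (m2 := Pr) f mf
    (fun p => excess_to_go_ge0 _ _).
  by move=> mF; exact: (measurableT_comp mF mxk).
rewrite integral_Ex; last exact: bounded_rv_excess_stage.
congr (_ + _)%E.
under eq_bigr => i _ do rewrite /bump/= add1n -addSnnS.
rewrite IH.
pose F (p : borel R nx * borel R nw) := excess_to_go T (step p.1 p.2).
have mF : measurable_fun setT F.
  by apply: (measurableT_comp (measurable_excess_to_go T));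
    apply: measurable_step; [exact: measurable_fst|exact: measurable_snd].
exact: (freezing hw (@closed_loop_measurable k) mF
  (fun p => excess_to_go_ge0 _ _)).
Qed.

Lemma ae_excess_sums_bounded :
  {ae Pr, forall om, exists M, forall T,
    \sum_(k < T) excess_stage (x k om) <= M}.
Proof.
have [v [M fea]] := hx0.
apply: (@ae_bounded_sums _ _ _ Pr (fun k om => excess_stage (x k om))
  (excess x0 v M)).
- exact: bounded_rv_excess_stage.
- by move=> k om; exact: excess_stage_ge0.
move=> T; rewrite -lee_fin -sumEFin.
have := sum_Ex_excess_stage T 0; under eq_bigr do rewrite add0n.
move=> -> /=; rewrite integral_cst//= probability_setT mule1.
exact: excess_to_go_le.
Qed.


Local Notation ell := (noise_cost D Pr w P).

(** The coefficient of the disturbance in the completed square of time [k]. *)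
Definition drift k om :=
  D^T *m ((P + P^T) *m (A *m x k om + B *m kappa (x k om))).

(** The part of the stage cost of time [k] that the disturbance [w k]
  contributes, after removing its mean. *)
Definition increment k om :=
  dot (drift k om) (w k om) + (qform P (D *m w k om) - ell).

Definition martingale k om := \sum_(j < k) increment j om.

Lemma bounded_rvec_drift k : bounded_rvec (drift k : past w k -> 'cV[R]_nw).
Proof.
have [bx bu] := bounded_rvec_closed_loop k.
do 2 apply: bounded_rvec_mulmx.
by apply: bounded_rvecD; apply: bounded_rvec_mulmx.
Qed.

Lemma norm_qform_noise_le e : W e ->
  `|qform P (D *m e)| <= nx%:R ^+ 2 * `|P| * (nw%:R * `|D| * Cw) ^+ 2.
Proof.
move=> We; rewrite (le_trans (norm_qform_le _ _))//.
apply: ler_wpM2l; first by rewrite mulr_ge0.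
have Cw0 : 0 <= Cw := le_trans (normr_ge0 _) (WC hW0).
rewrite lerXn2r ?nnegrE ?mulr_ge0// (le_trans (norm_mulmx_le _ _))//.
by apply: ler_wpM2l; [rewrite mulr_ge0|exact: WC].
Qed.

Lemma increment_bounded : exists C, forall k om, `|increment k om| <= C.
Proof.
pose Cs := nx%:R * `|A| * Cz + nu%:R * `|B| * Cz.
exists (nw%:R * (nx%:R * `|D^T| * (nx%:R * `|P + P^T| * Cs)) * Cw +
  (nx%:R ^+ 2 * `|P| * (nw%:R * `|D| * Cw) ^+ 2 + `|ell|)) => k om.
rewrite (le_trans (ler_normD _ _))// lerD//; last first.
  by rewrite (le_trans (ler_normB _ _))// lerD// norm_qform_noise_le.
rewrite (le_trans (norm_dot_le _ _))//; apply: ler_pM; rewrite ?mulr_ge0//.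
apply: ler_wpM2l => //; rewrite (le_trans (norm_mulmx_le _ _))//.
apply: ler_wpM2l; first by rewrite mulr_ge0.
rewrite (le_trans (norm_mulmx_le _ _))//.
apply: ler_wpM2l; first by rewrite mulr_ge0.
have [xC uC] := closed_loop_bounded k om.
rewrite (le_trans (ler_normD _ _))// lerD// (le_trans (norm_mulmx_le _ _))//;
  by apply: ler_wpM2l; rewrite ?mulr_ge0.
Qed.

Lemma bounded_rv_increment j k : (j < k)%N ->
  bounded_rv (increment j : past w k -> R).
Proof.
move=> jk; have bw := bounded_rvec_noise_past wC jk.
apply: bounded_rvD.
  apply: bounded_rv_dot => // i.
  exact: (bounded_rv_past (ltnW jk) (@bounded_rvec_drift j i)).
apply: bounded_rvD; last exact: bounded_rv_cst.
by apply: bounded_rv_qform; exact: bounded_rvec_mulmx.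
Qed.

Lemma bounded_rv_martingale k : bounded_rv (martingale k : past w k -> R).
Proof. by apply: bounded_rv_sum => j _; exact: bounded_rv_increment. Qed.

Lemma martingale_increment_orth k :
  Ex Pr (fun om => martingale k om * increment k om) = 0.
Proof.
have bM := bounded_rv_martingale k.
have bw : bounded_rvec (w k) := bounded_rvec_noise hw wC k.
pose g (v : borel R nw) : R := qform P (D *m v) - ell.
have mg : measurable_fun setT g.
  apply: measurable_funB => //; apply: measurable_qform.
  exact: (@measurable_vec_mulmx _ _ (borel R nw) _ _ D id).
have gC j om : `|g (w j om)| <= nx%:R ^+ 2 * `|P| * (nw%:R * `|D| * Cw) ^+ 2 +
  `|ell|.
  by rewrite (le_trans (ler_normB _ _))// lerD// norm_qform_noise_le.
have bMd : bounded_rvec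
  ((fun om => martingale k om *: drift k om) : past w k -> 'cV[R]_nw).
  by move=> i; under eq_fun do rewrite mxE; apply: bounded_rvM => //;
    exact: bounded_rvec_drift.
rewrite (_ : (fun om => _) = fun om =>
  dot (martingale k om *: drift k om) (w k om) +
    martingale k om * g (w k om)); last first.
  apply/funext => om; rewrite /increment mulrDr; congr (_ + _).
  by rewrite !dotE mulr_sumr; apply: eq_bigr => i _; rewrite [in RHS]mxE mulrA.
rewrite ExD; last 2 first.
- apply: bounded_rv_dot => // i; exact: (bounded_rv_of_past hw (bMd i)).
- apply: bounded_rvM; first exact: (bounded_rv_of_past hw bM).
  exact: (bounded_rv_noise hw mg gC).
rewrite (Ex_dot_noise hw wC hmean bMd) add0r (Ex_past_noise hw mg gC bM).
rewrite [X in _ * X](_ : _ = 0) ?mulr0// /g.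
rewrite ExD ?Ex_cst;
  [|by apply: bounded_rv_qform; apply: bounded_rvec_mulmx;
  exact: (bounded_rvec_noise hw wC)|exact: bounded_rv_cst].
by rewrite subrr.
Qed.

Lemma ae_martingale_average :
  {ae Pr, forall om, k%:R^-1 * martingale k om @[k --> \oo] --> 0}.
Proof.
have [C incC] := increment_bounded.
apply: (@martingale_lln _ _ _ Pr martingale increment C) => //.
- by move=> om; rewrite /martingale big_ord0.
- by move=> k om; rewrite /martingale big_ord_recr.
- by move=> k; exact: (bounded_rv_of_past hw (bounded_rv_increment (ltnSn k))).
- exact: martingale_increment_orth.
Qed.

(** Sum of the completed squares along the closed loop. *)
Lemma sum_stage_cost k om :
  \sum_(1 <= j < k.+1) (qform Q (x j om) + qform Rw (kappa (x j om))) =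
  qform P (x 1 om) - qform P (x k.+1 om) +
  (\sum_(j < k.+1) excess_stage (x j om) - excess_stage (x 0 om)) +
  (martingale k.+1 om - martingale 1 om) + k%:R * ell.
Proof.
elim: k => [|k IH].
  by rewrite big_geq// big_ord_recr big_ord0/=; lra.
have mS : martingale k.+2 om = martingale k.+1 om + increment k.+1 om.
  by rewrite /martingale big_ord_recr.
rewrite big_nat_recr// IH [in RHS]big_ord_recr mS -natr1 mulrDl mul1r.
have := qform_step D hR hP hRiccati hK (x k.+1 om) (kappa (x k.+1 om))
  (w k.+1 om).
rewrite -/(step _ _) -closed_loopS -/(correction _) -/(excess_stage _).
rewrite -/(drift k.+1 om) /increment /=; lra.
Qed.

Lemma ae_average_cost : {ae Pr, forall om,
  k%:R^-1 * \sum_(1 <= j < k.+1) (qform Q (x j om) + qform Rw (kappa (x j om)))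
    @[k --> \oo] --> ell}.
Proof.
have [C incC] := increment_bounded.
have aeM := ae_martingale_average; have aeS := ae_excess_sums_bounded.
move: aeM aeS; apply: filterS2 => om cvgM [b sumb].
have PC k : `|qform P (x k om)| <= nx%:R ^+ 2 * `|P| * Cz ^+ 2.
  rewrite (le_trans (norm_qform_le _ _))// ler_wpM2l ?mulr_ge0//.
  have [xC _] := closed_loop_bounded k om.
  by rewrite lerXn2r ?nnegrE// (le_trans _ xC).
set Cp := nx%:R ^+ 2 * _ * _ in PC.
(* all terms of the sum that stay bounded, and one martingale increment *)
pose c := Cp + Cp + b + excess_stage (x 0 om) + C + `|martingale 1 om|.
suff bnd k : (0 < k)%N ->
    `|k%:R^-1 * \sum_(1 <= j < k.+1)
      (qform Q (x j om) + qform Rw (kappa (x j om))) - ell|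
    <= k%:R^-1 * c + `|k%:R^-1 * martingale k om|.
  apply/cvgrPdist_le => e e0; have e20 : 0 < e / 2 by rewrite divr_gt0.
  have /cvgr0Pnorm_le/(_ _ e20) cvgM' := cvgM.
  have /cvgr0Pnorm_le/(_ _ e20) cvgc := cvg_invn_mul c.
  near=> k; rewrite distrC (le_trans (bnd k _))//; first by near: k;
    exact: nbhs_infty_gt.
  rewrite (splitr e) lerD//; last by near: k.
  by rewrite (le_trans (ler_norm _))//; near: k.
move=> k0; have k0R : (k%:R : R) != 0 by rewrite pnatr_eq0 -lt0n.
rewrite sum_stage_cost mulrDr (mulrA _ _ ell) mulVf// mul1r addrK.
have mS : martingale k.+1 om = martingale k om + increment k om.
  by rewrite /martingale big_ord_recr.
rewrite !normrM ger0_norm ?invr_ge0// -mulrDr ler_wpM2l ?invr_ge0//.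
have sum0 : 0 <= \sum_(j < k.+1) excess_stage (x j om).
  by apply: sumr_ge0 => j _; exact: excess_stage_ge0.
have := sumb k.+1; have := excess_stage_ge0 (x 0 om).
have := PC 1%N; have := PC k.+1; have := incC k om.
rewrite mS /c !ler_norml => /andP[? ?] /andP[? ?] /andP[? ?] ? ?.
have := ler_norm (martingale k om);
  have := lerNnormlW (lexx `|martingale k om|).
have := ler_norm (martingale 1 om);
  have := lerNnormlW (lexx `|martingale 1 om|).
move=> ? ? ? ?; apply/andP; split; lra.
Unshelve. all: by end_near.
Qed.

(** By [riccati_closed_loop] the contribution of each disturbance is a
  difference of two consecutive terms, and the sum telescopes. *)
Lemma noise_response_costE k :
  Ex Pr (fun om => qform (Q + K^T *m Rw *m K)
    (lin_traj (A + B *m K) D x0 (w^~ om) k)) =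
  qform (Q + K^T *m Rw *m K) ((A + B *m K) ^+ k *m x0) +
  (ell - Ex Pr (fun om => qform P ((A + B *m K) ^+ k *m D *m w 0%N om))).
Proof.
set F := A + B *m K; set M := Q + _.
under eq_fun do rewrite lin_trajE_rev.
rewrite (Ex_qform_affine hw wC hmean M _ (fun j => F ^+ (k.-1 - j) *m D));
  congr (_ + _).
have bF j : bounded_rv (fun om => qform P (F ^+ j *m D *m w 0%N om)).
  by apply: bounded_rv_qform; apply: bounded_rvec_mulmx;
    exact: (bounded_rvec_noise hw wC).
pose e j := Ex Pr (fun om => qform P (F ^+ j *m D *m w 0%N om)).
have eE j : Ex Pr (fun om => qform M (F ^+ j *m D *m w 0%N om)) = e j - e j.+1.
  rewrite /e -ExN// -ExD//; last exact: bounded_rvN.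
  congr (Ex _ _); apply/funext => om.
  rewrite /M (riccati_closed_loop hR hP hRiccati hK) -/F.
  by rewrite exprS !mulmxA.
have -> : ell = e 0%N by rewrite /e expr0;
  under [in RHS]eq_fun do rewrite mul1mx.
rewrite (reindex_inj rev_ord_inj)/=.
transitivity (\sum_(j < k) (e j - e j.+1)).
  apply: eq_bigr => -[j jk] _ /=; rewrite -eE; congr (Ex _ _);
    apply/funext => om.
  by rewrite subnS predn_sub subKn// -ltnS prednK// (leq_ltn_trans _ jk).
by rewrite -opprB -(telescope_sumr e (leq0n k)) big_mkord -sumrN;
  apply: eq_bigr => j _; rewrite opprB.
Qed.

Hypothesis hPhi : (fun k => (A + B *m K) ^+ k) @ \oo --> (0 : 'M[R]_nx).

Lemma cvg_noise_response_cost :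
  (fun k => Ex Pr (fun om => qform (Q + K^T *m Rw *m K)
    (lin_traj (A + B *m K) D x0 (w^~ om) k))) @ \oo --> ell.
Proof.
have Cw0 : 0 <= Cw := le_trans (normr_ge0 _) (WC hW0).
set F := A + B *m K;
  have F0m : (fun k => F ^+ k) @ \oo --> (0 : 'M[R]_nx) := hPhi.
have F0 : (fun k => `|F ^+ k|) @ \oo --> 0.
  by rewrite -(normr0 'M[R]_nx); exact: cvg_norm.
have sqr0 c : (fun k => c * (`|F ^+ k| * `|F ^+ k|)) @ \oo --> 0.
  by rewrite -(mulr0 c) -(mulr0 (0 : R)); apply: cvgMr; exact: cvgM.
have qle M n (G : 'M[R]_(nx, n)) e (C : R) : `|e| <= C -> forall k,
    `|qform M (F ^+ k *m G *m e)| <=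
    nx%:R ^+ 2 * `|M| * (n%:R * (nx%:R * `|G|) * C) ^+ 2 *
      (`|F ^+ k| * `|F ^+ k|).
  move=> eC k; have C0 : 0 <= C := le_trans (normr_ge0 _) eC.
  rewrite (le_trans (norm_qform_le _ _))// -[leRHS]mulrA.
  apply: ler_wpM2l; first by rewrite mulr_ge0.
  rewrite -expr2 -exprMn lerXn2r ?nnegrE ?mulr_ge0//.
  rewrite (le_trans (norm_mulmx_le _ _))//.
  rewrite (_ : _ * C * _ = n%:R * (nx%:R * `|F ^+ k| * `|G|) * C); last by ring.
  by rewrite ler_pM ?mulr_ge0// ler_wpM2l// norm_mulmx_le.
pose e k := Ex Pr (fun om => qform P (F ^+ k *m D *m w 0%N om)).
have bPF k : bounded_rv (fun om => qform P (F ^+ k *m D *m w 0%N om)).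
  by apply: bounded_rv_qform; apply: bounded_rvec_mulmx;
    exact: (bounded_rvec_noise hw wC).
have e0 : e @ \oo --> 0.
  pose c := nx%:R ^+ 2 * `|P| * (nw%:R * (nx%:R * `|D|) * Cw) ^+ 2.
  apply: (@squeeze_cvgr _ _ _ _ (fun=> 0)
    (fun k => c * (`|F ^+ k| * `|F ^+ k|))).
  - apply: nearW => k; rewrite /e Ex_ge0//=; last by move=> om; exact: pd_ge0.
    rewrite -[leRHS](Ex_cst Pr); apply: Ex_le => //;
      first exact: bounded_rv_cst.
    by move=> om; exact: le_trans (ler_norm _) (qle P _ D _ _ (wC 0%N om) k).
  - exact: cvg_cst.
  - exact: sqr0.
have q0 : (fun k => qform (Q + K^T *m Rw *m K) (F ^+ k *m x0)) @ \oo --> 0.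
  apply/cvgr0Pnorm_le => eps eps0.
  have /cvgr0Pnorm_le/(_ eps eps0) := sqr0 (nx%:R ^+ 2 * `|Q + K^T *m Rw *m K| *
    (nx%:R * (nx%:R * `|1%:M : 'M[R]_nx|) * `|x0|) ^+ 2).
  apply: filterS => k; apply: le_trans.
  have := qle (Q + K^T *m Rw *m K) _ 1%:M x0 _ (lexx _) k.
  by rewrite mulmx1 => /le_trans; apply; exact: ler_norm.
rewrite [X in X @ \oo](_ : _ = fun k =>
    qform (Q + K^T *m Rw *m K) (F ^+ k *m x0) + (ell - e k)); last first.
  by apply/funext => k; rewrite noise_response_costE.
have lim := cvgD q0 (cvgB (cvg_cst ell) e0); rewrite subr0 add0r in lim.
exact: lim.
Qed.

Section Absorption.
(* a radius for which the closed ball lies in Xf, and later in Sinf *)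
Variable rho : R.
Hypothesis rho_gt0 : 0 < rho.
Hypothesis hXfrho : forall y, `|y| <= rho -> Xf y.

Let ball_event k : measurable [set om | `|x k om| <= rho].
Proof.
have mx := past_measurable_fun hw (@closed_loop_measurable k).
have mn : measurable_fun setT (fun y : borel R nx => `|y|).
  by apply: continuous_borel_measurable; exact: norm_continuous.
have := measurableT_comp mn mx measurableT (measurable_itv `]-oo, rho]).
by rewrite setTI; congr measurable; apply/seteqP; split=> om /=; rewrite in_itv.
Qed.

Hypothesis hsmall : forall lam : R, 0 < lam ->
  (0 < Pr [set om | (`|w 0%N om| <= lam)%R])%E.

Lemma correction_cvg0 (om : Omega) b :
  (forall T, \sum_(k < T) excess_stage (x k om) <= b) ->
  (fun k => correction (x k om)) @ \oo --> (0 : 'cV[R]_nu).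
Proof.
move=> sb; apply/cvg_mx0P => i j; rewrite ord1.
have [a a0 Ha] := pd_coord_sqr_le i (riccati_weight_pd B hR hP).
have c20 := bounded_sums_cvg0 (fun k => excess_stage_ge0 (x k om)) sb.
apply/cvgr0Pnorm_le => e e0.
have ea : 0 < e ^+ 2 / a by rewrite divr_gt0// exprn_gt0.
have /cvgr0Pnorm_le/(_ _ ea) := c20; apply: filterS => k.
rewrite ger0_norm ?excess_stage_ge0// ler_pdivlMr// mulrC => ek.
rewrite -ler_sqr ?nnegrE ?(ltW e0)// real_normK ?num_real//.
exact: le_trans (Ha _) ek.
Qed.

(** Over a long block without corrections or disturbances the state would shrink
  to [rho / 2]; the corrections vanish and the disturbances stay small during
  arbitrarily late blocks, and together they contribute at most another [rho /
  2]. *)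
Lemma ae_hit_ball : {ae Pr, forall om, exists k, `|x k om| <= rho}.
Proof.
have Cz0 : 0 <= Cz := le_trans (normr_ge0 _) (closed_loop_bounded 0 point).1.
set F := A + B *m K.
have r2 : 0 < rho / 2 by rewrite divr_gt0.
have [m Fm] : exists m, nx%:R * `|F ^+ m| * Cz <= rho / 2.
  have dz : 0 < nx%:R * Cz + 1 by rewrite ltr_wpDl ?mulr_ge0.
  have /cvgr0Pnorm_le/(_ _ (divr_gt0 r2 dz))[m _ Hm] := hPhi.
  exists m; have := Hm m (leqnn m); rewrite /= ler_pdivlMr// => Hm'.
  apply: le_trans Hm'; rewrite mulrDr mulr1 -mulrA mulrCA.
  by rewrite lerDl.
(* amplification of the perturbations over a block of length m *)
pose kap := \sum_(j < m) (nx%:R * `|F|) ^+ j.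
have kap0 : 0 <= kap by apply: sumr_ge0 => j _; rewrite exprn_ge0 ?mulr_ge0.
(* eta bounds each perturbation; one half of it is for B c, the other for D w *)
pose eta := rho / 2 / (kap + 1).
have kap1 : 0 < kap + 1 by rewrite ltr_wpDl.
have eta0 : 0 < eta by rewrite divr_gt0.
have eta2 : 0 < eta / 2 by rewrite divr_gt0.
have bB : 0 < nu%:R * `|B| + 1 by rewrite ltr_wpDl ?mulr_ge0.
have bD : 0 < nw%:R * `|D| + 1 by rewrite ltr_wpDl ?mulr_ge0.
pose lam := eta / 2 / (nw%:R * `|D| + 1).
have lam0 : 0 < lam by rewrite divr_gt0.
pose E : set (borel R nw) := [set v | `|v| <= lam].
have mE : measurable E.
  have mn : measurable_fun setT (fun y : borel R nw => `|y|).
    by apply: continuous_borel_measurable; exact: norm_continuous.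
  have := mn measurableT _ (measurable_itv `]-oo, lam]).
  by rewrite setTI; congr measurable; apply/seteqP; split=> v /=;
    rewrite in_itv.
have aeS := ae_excess_sums_bounded.
have aeB := ae_small_blocks hw mE (hsmall lam0) m.
move: aeS aeB; apply: filterS2 => om [b sb] blocks.
have /cvgr0Pnorm_le/(_ _ (divr_gt0 eta2 bB))[T _ HT] := correction_cvg0 sb.
have [t Tt wE] := blocks T.
exists (t + m)%N.
pose r j := B *m correction (x (t + j)%N om) + D *m w (t + j)%N om.
have rle j : (j < m)%N -> `|r j| <= eta.
  move=> jm; rewrite (splitr eta) (le_trans (ler_normD _ _))// lerD//.
    rewrite (le_trans (norm_mulmx_le _ _))//.
    have := HT (t + j)%N (leq_trans Tt (leq_addr _ _));
      rewrite /= ler_pdivlMr// => H.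
    by apply: le_trans H; rewrite mulrDr mulr1 mulrC lerDl.
  rewrite (le_trans (norm_mulmx_le _ _))//.
  have := wE j jm; rewrite /E/= /lam ler_pdivlMr// => H.
  by apply: le_trans H; rewrite mulrDr mulr1 mulrC lerDl.
have yS j : x (t + j.+1)%N om = F *m x (t + j)%N om + r j.
  by rewrite addnS closed_loopS stepE -addrA.
have := contraction_block yS rle; rewrite addn0 -/kap => blk.
rewrite -[X in `|X|](subrK (F ^+ m *m x t om)) (le_trans (ler_normD _ _))//.
rewrite (splitr rho) lerD//.
  apply: le_trans blk _; rewrite /eta mulrCA ger_pMr// ler_pdivrMr//.
  by rewrite mul1r lerDl.
rewrite (le_trans (norm_mulmx_le _ _))// (le_trans _ Fm)//.
by apply: ler_wpM2l; [rewrite mulr_ge0|have [] := closed_loop_bounded t om].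
Qed.

Variable Sinf : set 'cV[R]_nx.
Hypothesis hSrho : forall y, `|y| <= rho -> Sinf y.
Hypothesis hSstep : forall y e, Sinf y -> W e ->
  Sinf ((A + B *m K) *m y + D *m e).

(** In the terminal set the correction vanishes, so the closed loop follows the
  linear dynamics that leaves both sets invariant. *)
Lemma absorbed t k om : (t <= k)%N -> `|x t om| <= rho ->
  Sinf (x k om) /\ Xf (x k om).
Proof.
move=> tk xt; rewrite -(subnKC tk); elim: (k - t)%N => [|j [IHS IHX]].
  by rewrite addn0; split; [exact: hSrho|exact: hXfrho].
rewrite addnS closed_loopS stepE terminal_correction0// mulmx0 addr0.
split; first exact: hSstep.
by have [_] := hXf IHX; apply.
Qed.

(** The events of having visited the ball by time [k] are measurable, increase
  to a set of probability 1 and are contained in the events of interest, which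
  therefore have inner measure tending to 1. *)
Lemma prob_in_absorbed_cvg1 :
  prob_in Pr [set om | Sinf (x k om)] @[k --> \oo] --> 1%E.
Proof.
pose F k := \bigcup_(t in [set t | (t <= k)%N]) [set om | `|x t om| <= rho].
have mF k : measurable (F k).
  by apply: fin_bigcup_measurable => [|t _];
    [exact: (finite_II k.+1)|exact: ball_event].
have mUF : measurable (\bigcup_k F k) by exact: bigcupT_measurable.
have ndF : nondecreasing_seq F.
  move=> i j ij; apply/subsetPset => om [t /= ti xt]; exists t => //.
  exact: leq_trans ti ij.
have PUF : Pr (\bigcup_k F k) = 1%E.
  apply/eqP; rewrite eq_le probability_le1//=.
  have [H [mH PH hH]] := ae_hit_ball.
  have <- : Pr (~` H) = 1%E by rewrite probability_setC// PH sube0.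
  apply: le_measure; rewrite ?inE//; first exact: measurableC.
  move=> om nH; apply: contrapT => nU; apply: nH; apply: hH => -[t xt].
  by apply: nU; exists t => //; exists t => /=.
have cvgF : (Pr \o F) @ \oo --> 1%E by rewrite -PUF;
  exact: nondecreasing_cvg_mu.
apply: (squeeze_cvge _ cvgF (cvg_cst _)).
apply: nearW => k /=; apply/andP; split.
  apply: ereal_sup_ubound; exists (F k) => //; split => // om [t /= tk xt].
  by have [] := absorbed tk xt.
apply: ge_ereal_sup => _ [E [mE _] <-]; exact: probability_le1.
Qed.

End Absorption.

End ClosedLoop.

(** * Convergence of the closed loop *)

Theorem theorem5 (R : realType) (nx nu nw : nat)
  (A : 'M[R]_nx) (B : 'M[R]_(nx, nu)) (D : 'M[R]_(nx, nw))
  (d : measure_display) (Omega : measurableType d) (Pr : probability Omega R)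
  (w : nat -> Omega -> 'cV[R]_nw) (W : set 'cV[R]_nw)
  (Z : set ('cV[R]_nx * 'cV[R]_nu))
  (Q Qhalf P : 'M[R]_nx) (Rw : 'M[R]_nu) (K : 'M[R]_(nu, nx))
  (Xf : set 'cV[R]_nx) (N : nat) (kappa : 'cV[R]_nx -> 'cV[R]_nu)
  (* system and disturbance *)
  (hAB : stabilizable A B)
  (hWbounded : bounded_set W)
  (hW0 : W° 0)
  (hwW : forall k om, W (w k om))
  (hiid : iid Pr w)
  (hmean : forall k i, ('E_Pr[fun om => w k om i ord0] = 0)%E)
  (hnonsing : forall k, ~ singular_law Pr (w k))
  (hsmall : forall k (lam : R), 0 < lam ->
     (0 < Pr [set om | (`|w k om| <= lam)%R])%E)
  (* constraints *)
  (hZconvex : convex_set Z)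
  (hZcompact : compact Z)
  (hZ0 : Z° (0, 0))
  (* weights *)
  (hQ : psd Q) (hR : pd Rw) (hP : pd P)
  (hQhalf : is_psd_sqrt Qhalf Q)
  (hAQ : detectable A Qhalf)
  (hRiccati : P = Q + A^T *m P *m A - K^T *m (Rw + B^T *m P *m B) *m K)
  (hK : K = - (invmx (Rw + B^T *m P *m B) *m B^T *m P *m A))
  (hPhi : schur_stable (A + B *m K))
  (* terminal set *)
  (hXf0 : Xf° 0)
  (hXf : forall x, Xf x -> Z (x, K *m x) /\
     forall dist, W dist -> Xf ((A + B *m K) *m x + D *m dist))
  (* receding horizon law *)
  (hN : (0 < N)%N)
  (hkappa : receding_horizon_law A B D Pr Q Rw P w W Z Xf N kappa)
  (hkappa_meas : measurable_fun setT (kappa : borel R nx -> borel R nu))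
  (hcontr : controllable (A + B *m K) D)
  (x0 : 'cV[R]_nx) (hx0 : feasible_set A B D W Z Xf N x0) :
  let x k om := closed_loop A B D kappa x0 (w^~ om) k in
  let u k om := kappa (x k om) in
  let xi k om := lin_traj (A + B *m K) D x0 (w^~ om) k in
  prob_in Pr [set om | minkowski_series (A + B *m K) D W (x k om)]
    @[k --> \oo] --> 1%E /\
  exists l : R,
    ('E_Pr[fun om => qform (Q + K^T *m Rw *m K)%R (xi k om)])%E
      @[k --> \oo] --> l%:E /\
    {ae Pr, forall om,
      k%:R^-1 * \sum_(1 <= j < k.+1) (qform Q (x j om) + qform Rw (u j om))
        @[k --> \oo] --> l}.
Proof.
move=> x u xi.
have W0 : W 0 := nbhs_singleton hW0.
have [Cw WC] : exists Cw, forall e, W e -> `|e| <= Cw.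
  have [M [_ WM]] := hWbounded; exists (M + 1) => e We.
  by apply: WM => //; rewrite ltrDl.
have [Cz ZC] : exists Cz, forall x u, Z (x, u) -> `|x| <= Cz /\ `|u| <= Cz.
  have [M [_ ZM]] := compact_bounded hZcompact; exists (M + 1) => y v Zyv.
  have : `|(y, v)| <= M + 1 by apply: ZM => //; rewrite ltrDl.
  by rewrite prod_normE ge_max => /andP.
have Phi0 := schur_stable_powers_cvg0 hPhi.
split.
  have /nbhs_ballP[r /= r0 rS] : nbhs (0 : 'cV[R]_nx)
      [set y | minkowski_series (A + B *m K) D W y /\ Xf y].
    by apply: filterI; [exact: minkowski_series_ball|exact: hXf0].
  have inball (y : 'cV[R]_nx) : `|y| <= r / 2 -> ball (0 : 'cV[R]_nx) r y.
    move=> yr; rewrite -ball_normE/= sub0r normrN (le_lt_trans yr)//.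
    by rewrite ltr_pdivrMr// ltr_pMr// ltr1n.
  apply: (@prob_in_absorbed_cvg1 _ _ _ _ A B D _ _ Pr w W Cw Z Cz hwW W0 WC
    hiid hmean ZC
    Q P Rw K hR hP hRiccati hK Xf N kappa hXf hN hkappa hkappa_meas x0 hx0 Phi0
      (r / 2)).
  - by rewrite divr_gt0.
  - by move=> y /inball/rS[].
  - exact: hsmall.
  - by move=> y /inball/rS[].
  - by move=> y e Sy We; exact: minkowski_series_step.
exists (noise_cost D Pr w P); split.
  have bxi k : bounded_rv (fun om => qform (Q + K^T *m Rw *m K) (xi k om)).
    apply: bounded_rv_qform; rewrite /xi; under eq_fun do rewrite lin_trajE_rev.
    apply: bounded_rvecD; first exact: bounded_rvec_cst.
    apply: bounded_rvec_sum => j _; apply: bounded_rvec_mulmx.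
    exact: (bounded_rvec_noise hiid (fun j om => WC _ (hwW j om))).
  under eq_fun do rewrite expectation_Ex//.
  apply: cvg_EFin; first exact: nearW.
  exact: (@cvg_noise_response_cost _ _ _ _ A B D _ _ Pr w W Cw hwW W0 WC hiid
    hmean
    Q P Rw K hR hP hRiccati hK x0 Phi0).
exact: (@ae_average_cost _ _ _ _ A B D _ _ Pr w W Cw Z Cz hwW W0 WC hiid hmean
  ZC
    Q P Rw K hR hP hRiccati hK Xf N kappa hXf hN hkappa hkappa_meas x0 hx0).
Qed.
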